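(* Let $R$ be a ring, $\mathfrak{l}=\mathfrak{l}_R$, and $\pi':R\to R':=R/\mathfrak{l}$, $r\mapsto r+\mathfrak{l}$. The following statements are equivalent. 1. The ring $R$ is a weakly left localizable ring such that (a) the map $\phi:\mathrm{max.Den}_l(R)\to \mathrm{max.Den}_l(R')$, $S\mapsto \pi'(S)$, is a surjection, (b) $|\mathrm{max.Den}_l(R)|<\infty$, (c) for every $S\in \mathrm{max.Den}_l(R)$, $S^{-1}R$ is a weakly left localizable ring, and (d) for all $S,T\in \mathrm{max.Den}_l(R)$ such that $S\neq T$, $\mathrm{ass}(S)$ is not a nil ideal modulo $\mathrm{ass}(T)$. 2. $Q_{l,cl}(R')$ exists and $Q_{l,cl}(R')\simeq \prod_{i=1}^n R_i$ for some $n\ge 1$, where the $R_i$ are local rings with $\mathrm{rad}(R_i)=\mathcal{N}_{R_i}$; $\mathfrak{l}$ is a nil ideal; and $\pi'(\mathcal{L}_l(R))=\mathcal{L}_l(R')$. 3. $Q_l(R')\simeq \prod_{i=1}^n R_i$ for some $n\ge 1$, where the $R_i$ are local rings with $\mathrm{rad}(R_i)=\mathcal{N}_{R_i}$; $\mathfrak{l}$ is a nil ideal; and $\pi'(\mathcal{L}_l(R))=\mathcal{L}_l(R')$.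
   Context: All rings are associative with $1\neq 0$; ideals are two-sided. For a ring $R$: $R^*$ is the group of units, $\mathcal{C}_R$ is the set of (left and right) regular elements, i.e. non-zero-divisors, $\mathrm{rad}(R)$ is the Jacobson radical, $\mathrm{Nil}(R)$ is the set of nilpotent elements, and $\mathcal{N}_R$ is the nil radical, i.e. the sum of all nil ideals of $R$. A ring $R$ is local if $R\setminus R^*$ is an ideal of $R$ (equivalently, $R/\mathrm{rad}(R)$ is a division ring). A subset $S\subseteq R$ closed under multiplication with $1\in S$, $0\notin S$ is a left Ore set if $Sr\cap Rs\neq\emptyset$ for all $r\in R$, $s\in S$; then $\mathrm{ass}(S):=\{r\in R: sr=0\text{ for some }s\in S\}$ is an ideal. A left Ore set $S$ is a left denominator set if $rs=0$ with $r\in R$, $s\in S$ implies $tr=0$ for some $t\in S$. For a left denominator set $S$, $S^{-1}R=\{s^{-1}r: s\in S,r\in R\}$ is the left localization of $R$ at $S$; the kernel of $R\to S^{-1}R$, $r\mapsto \frac r1$, is $\mathrm{ass}(S)$. $\mathrm{Den}_l(R)$ is the set of left denominator sets of $R$, and $\mathrm{max.Den}_l(R)$ is the (non-empty) set of its maximal elements with respect to inclusion. $\mathfrak{l}_R:=\bigcap_{S\in \mathrm{max.Den}_l(R)}\mathrm{ass}(S)$ is the left localization radical of $R$. For every ring $R$ and $S\in\mathrm{max.Den}_l(R)$, the image of $S$ in $R/\mathfrak{l}_R$ belongs to $\mathrm{max.Den}_l(R/\mathfrak{l}_R)$, so $\phi$ is well defined. $Q_{l,cl}(R):=\mathcal{C}_R^{-1}R$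 is the classical left quotient ring; it exists iff $\mathcal{C}_R$ is a left Ore set. There is a largest left denominator set $S_{l,0}(R)$ among those with $\mathrm{ass}=0$ (equivalently, the largest left Ore set consisting of regular elements), and $Q_l(R):=S_{l,0}(R)^{-1}R$ is the largest left quotient ring of $R$. An element of $R$ is left localizable if it belongs to some left denominator set of $R$; $\mathcal{L}_l(R)$ is the set of left localizable elements of $R$. The ring $R$ is weakly left localizable if every non-nilpotent element of $R$ is left localizable. For ideals $\mathfrak a,\mathfrak b$ of $R$, ''$\mathfrak a$ is a nil ideal modulo $\mathfrak b$'' means that $(\mathfrak a+\mathfrak b)/\mathfrak b$ is a nil ideal of $R/\mathfrak b$. *)

(* Defs.v *)
From HB Require Import structures.
From mathcomp Require Import all_boot all_algebra.
From mathcomp Require Import boolp classical_sets functions cardinality.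

Set Implicit Arguments.
Unset Strict Implicit.
Unset Printing Implicit Defensive.

Import GRing.Theory.
Local Open Scope classical_set_scope.
Local Open Scope ring_scope.

(* Rings are [nzRingType]: associative, with 1 != 0, not necessarily
   commutative. Subsets are classical sets [set R]. *)

Section Elements.
Variable R : nzRingType.

(* [GRing.unit] is not available on a bare [nzRingType]. *)
Definition units : set R := [set x | exists y, x * y = 1 /\ y * x = 1].

Definition regular_elements : set R :=
  [set c | (forall r, c * r = 0 -> r = 0) /\ (forall r, r * c = 0 -> r = 0)].

Definition nilpotent_elements : set R := [set x | exists n, x ^+ n = 0].

End Elements.

Arguments units : clear implicits.
Arguments regular_elements : clear implicits.
Arguments nilpotent_elements : clear implicits.

Section Ideals.
Variable R : nzRingType.
Implicit Type I : set R.

Definition is_left_ideal I :=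
  [/\ I 0, (forall x y, I x -> I y -> I (x + y))
         & (forall a x, I x -> I (a * x))].

Definition is_ideal I := is_left_ideal I /\ forall a x, I x -> I (x * a).

Definition is_nil_ideal I := is_ideal I /\ I `<=` nilpotent_elements R.

Definition maximal_left_ideal : set (set R) :=
  [set M | [/\ is_left_ideal M, M <> setT
             & forall J, is_left_ideal J -> M `<=` J -> J = M \/ J = setT]].

Definition jacobson_radical : set R := \bigcap_(M in maximal_left_ideal) M.

(* The sum of all nil ideals: all finite sums of elements of nil ideals. *)
Definition nil_radical : set R :=
  [set x | exists s : seq R,
     (forall y, y \in s -> exists I, is_nil_ideal I /\ I y)
     /\ x = \sum_(y <- s) y].

Definition local_ring := is_ideal (~` units R).

Record properIdeal := ProperIdeal {
  ideal_set :> set R;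
  ideal_axiom : is_ideal ideal_set;
  ideal_proper : ~ ideal_set 1
}.

End Ideals.

Arguments maximal_left_ideal : clear implicits.
Arguments jacobson_radical : clear implicits.
Arguments nil_radical : clear implicits.
Arguments local_ring : clear implicits.

(* The quotient of a (noncommutative) ring by a proper two-sided ideal: a ring
   structure on MathComp's quotient of the underlying additive group. *)
Section QuotientRing.
Variables (R : nzRingType) (J : properIdeal R).
Local Notation I := (ideal_set J).

Definition ideal_pred : {pred R} := fun x => `[< I x >].

Lemma ideal_predE x : (x \in ideal_pred) = `[< I x >]. Proof. by []. Qed.

Lemma ideal_pred_zmod : zmod_closed ideal_pred.
Proof.
have [[I0 ID IM] _] := ideal_axiom J.
split; first by apply/asboolP.
move=> x y /asboolP Ix /asboolP Iy; apply/asboolP.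
by apply: ID => //; rewrite -mulN1r; apply: IM.
Qed.

HB.instance Definition _ := GRing.isZmodClosed.Build R ideal_pred
  ideal_pred_zmod.

Definition quotient_ring := @Quotient.quot R ideal_pred.

HB.instance Definition _ := GRing.Zmodule.on quotient_ring.

Local Open Scope quotient_scope.

Definition to_quotient (x : R) : quotient_ring := \pi_quotient_ring x.

Lemma to_quotientP x y : to_quotient x = to_quotient y <-> I (x - y).
Proof.
split=> [/eqP|Ixy].
  by rewrite -(@Quotient.idealrBE R ideal_pred) => /asboolP.
by apply/eqP; rewrite -(@Quotient.idealrBE R ideal_pred); apply/asboolP.
Qed.

Lemma to_quotient_surj (q : quotient_ring) : exists x, to_quotient x = q.
Proof. by exists (repr q); rewrite /to_quotient reprK. Qed.

Lemma to_quotientD : {morph to_quotient : x y / x + y}.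
Proof. by move=> x y; rewrite /to_quotient (raddfD (\pi_quotient_ring)). Qed.

Definition quotient_mul (p q : quotient_ring) : quotient_ring :=
  to_quotient (repr p * repr q).

Lemma quotient_mulE x y :
  quotient_mul (to_quotient x) (to_quotient y) = to_quotient (x * y).
Proof.
have [[_ ID IM] IMr] := ideal_axiom J.
apply/to_quotientP; set x' := repr _; set y' := repr _.
have -> : x' * y' - x * y = x' * (y' - y) + (x' - x) * y.
  by rewrite mulrBr mulrBl addrA subrK.
by apply: ID; [apply: IM | apply: IMr]; apply/to_quotientP;
  rewrite /to_quotient reprK.
Qed.

Lemma quotient_mulA : associative quotient_mul.
Proof.
move=> p q r; have [x <-] := to_quotient_surj p.
have [y <-] := to_quotient_surj q; have [z <-] := to_quotient_surj r.
by rewrite !quotient_mulE mulrA.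
Qed.

Lemma quotient_mul1r : left_id (to_quotient 1) quotient_mul.
Proof.
by move=> p; have [x <-] := to_quotient_surj p; rewrite quotient_mulE mul1r.
Qed.

Lemma quotient_mulr1 : right_id (to_quotient 1) quotient_mul.
Proof.
by move=> p; have [x <-] := to_quotient_surj p; rewrite quotient_mulE mulr1.
Qed.

Lemma quotient_mulDl : left_distributive quotient_mul +%R.
Proof.
move=> p q r; have [x <-] := to_quotient_surj p.
have [y <-] := to_quotient_surj q; have [z <-] := to_quotient_surj r.
by rewrite -to_quotientD !quotient_mulE -to_quotientD mulrDl.
Qed.

Lemma quotient_mulDr : right_distributive quotient_mul +%R.
Proof.
move=> p q r; have [x <-] := to_quotient_surj p.
have [y <-] := to_quotient_surj q; have [z <-] := to_quotient_surj r.
by rewrite -to_quotientD !quotient_mulE -to_quotientD mulrDr.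
Qed.

Lemma quotient_1neq0 : to_quotient 1 != 0.
Proof.
apply/eqP; rewrite -(raddf0 (\pi_quotient_ring)) => /to_quotientP.
by rewrite subr0; apply: ideal_proper.
Qed.

HB.instance Definition _ := GRing.Zmodule_isNzRing.Build quotient_ring
  quotient_mulA quotient_mul1r quotient_mulr1 quotient_mulDl quotient_mulDr
  quotient_1neq0.

Lemma to_quotient_zmod : zmod_morphism to_quotient.
Proof. by move=> x y; rewrite /to_quotient (raddfB (\pi_quotient_ring)). Qed.

Lemma to_quotient_monoid : monoid_morphism to_quotient.
Proof. by split=> // x y; rewrite -quotient_mulE. Qed.

HB.instance Definition _ := GRing.isZmodMorphism.Build R quotient_ring
  to_quotient to_quotient_zmod.
HB.instance Definition _ := GRing.isMonoidMorphism.Build R quotient_ring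
  to_quotient to_quotient_monoid.

End QuotientRing.

Arguments to_quotient {R} J x.

Definition nil_modulo (R : nzRingType) (A : set R) (B : properIdeal R) :=
  is_nil_ideal (to_quotient B @` [set a + b | a in A & b in B]).

Section Denominators.
Variable R : nzRingType.
Implicit Type S : set R.

Definition multiplicative S :=
  [/\ S 1, ~ S 0 & forall s t, S s -> S t -> S (s * t)].

Definition left_Ore S :=
  multiplicative S /\
  forall r s, S s -> exists s' r', S s' /\ s' * r = r' * s.

Definition ass S : set R := [set r | exists2 s, S s & s * r = 0].

Definition left_denominator S :=
  left_Ore S /\
  forall r s, S s -> r * s = 0 -> exists2 t, S t & t * r = 0.

Definition Den_l : set (set R) := [set S | left_denominator S].

Definition max_Den_l : set (set R) :=
  [set S | Den_l S /\ forall T, Den_l T -> S `<=` T -> T = S].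

Definition left_localizable : set R :=
  [set r | exists2 S, Den_l S & S r].

Definition weakly_left_localizable :=
  forall r, ~ nilpotent_elements R r -> left_localizable r.

Record denSet := DenSet { den_set :> set R; den_axiom : Den_l den_set }.

End Denominators.

Arguments Den_l : clear implicits.
Arguments max_Den_l : clear implicits.
Arguments left_localizable : clear implicits.
Arguments weakly_left_localizable : clear implicits.

Section AssIdeal.
Variables (R : nzRingType) (S : denSet R).

Lemma ass_is_ideal : is_ideal (ass S).
Proof.
case: S => A [[[S1 S0 SM] SO] SD] /=.
split; last first.
  by move=> a x [s Ss sx]; exists s; rewrite // mulrA sx mul0r.
split.
- by exists 1; rewrite ?mulr0.
- move=> x y [s Ss sx] [t St ty].
  have [s' [r' [Ss' e]]] := SO s t St.
  exists (s' * s); first exact: SM.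
  by rewrite mulrDr -mulrA sx mulr0 add0r e -mulrA ty mulr0.
- move=> a x [s Ss sx]; have [s' [r' [Ss' e]]] := SO a s Ss.
  by exists s' => //; rewrite mulrA e -mulrA sx mulr0.
Qed.

Lemma ass_proper : ~ ass S 1.
Proof.
case: S => A [[[S1 S0 SM] SO] SD] /= [s Ss].
by rewrite mulr1 => s0; rewrite s0 in Ss.
Qed.

Definition ass_ideal := ProperIdeal ass_is_ideal ass_proper.

End AssIdeal.

Section LocalizationRadical.
Variable R : nzRingType.

Lemma max_Den_l_neq0 : max_Den_l R !=set0.
Proof.
have D1 : Den_l R [set 1].
  split; last by move=> r s -> r0; exists 1; rewrite // mul1r -[r]mulr1.
  split; last by move=> r s ->; exists 1, r; rewrite mul1r mulr1.
  split=> //= [/esym/eqP|s t -> ->]; last by rewrite mulr1.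
  by rewrite oner_eq0.
have [|A [DA Amax]] := @Zorn_bigcup R (fun S => S = set0 \/ Den_l R S).
  move=> F FP Ftot.
  case: (pselect (exists2 B, F B & Den_l R B)) => [[B FB DB]|nB]; last first.
    left; apply/seteqP; split=> // x [C FC Cx].
    have [C0|DC] := FP _ FC; first by rewrite C0 in Cx.
    by case: nB; exists C.
  right.
  have FD C x : F C -> C x -> Den_l R C.
    by move=> FC Cx; have [C0|//] := FP _ FC; rewrite C0 in Cx.
  split; [split; [split|]|].
  - by exists B => //; have [[[]]] := DB.
  - by move=> [C FC C0]; have [[[_]]] := FD _ _ FC C0.
  - move=> s t [C FC Cs] [E FE Et].
    have [CE|EC] := Ftot _ _ FC FE.
      exists E => //; have [[[_ _ EM] _] _] := FD _ _ FE Et.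
      by apply: EM => //; apply: CE.
    exists C => //; have [[[_ _ CM] _] _] := FD _ _ FC Cs.
    by apply: CM => //; apply: EC.
  - move=> r s [C FC Cs]; have [[_ CO] _] := FD _ _ FC Cs.
    have [s' [r' [Cs' e]]] := CO r s Cs.
    by exists s', r'; split=> //; exists C.
  - move=> r s [C FC Cs] rs; have [_ CD] := FD _ _ FC Cs.
    by have [t Ct tr] := CD r s Cs rs; exists t => //; exists C.
have {}DA : Den_l R A.
  case: DA => // A0; case: (Amax [set 1]); last by right.
  by rewrite A0; split; [exact: sub0set | move=> /(_ 1 erefl)].
exists A; split=> // T DT AT; apply/seteqP; split=> //.
apply: contrapT => nTA; apply: (Amax T); last by right.
by split.
Qed.

Definition loc_radical_set : set R := \bigcap_(S in max_Den_l R) ass S.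

Lemma loc_radical_is_ideal : is_ideal loc_radical_set.
Proof.
split; first split.
- by move=> S [DS _]; have [[]] := ass_is_ideal (DenSet DS).
- move=> x y lx ly S mS; have [DS _] := mS.
  by have [[_ + _] _] := ass_is_ideal (DenSet DS); apply; [apply: lx|apply: ly].
- move=> a x lx S mS; have [DS _] := mS.
  by have [[_ _ +] _] := ass_is_ideal (DenSet DS); apply; apply: lx.
- move=> a x lx S mS; have [DS _] := mS.
  by have [_ +] := ass_is_ideal (DenSet DS); apply; apply: lx.
Qed.

Lemma loc_radical_proper : ~ loc_radical_set 1.
Proof.
have [S mS] := max_Den_l_neq0; have [DS _] := mS.
by move=> /(_ S mS); apply: (@ass_proper R (DenSet DS)).
Qed.

Definition loc_radical : properIdeal R :=
  ProperIdeal loc_radical_is_ideal loc_radical_proper.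

End LocalizationRadical.

(* The left localization S^-1 R, built as left fractions s^-1 r; [frac D s r]
   is s^-1 r when s is in S (and 1^-1 r otherwise). *)
Section Localization.
Variables (R : nzRingType) (D : denSet R).
Local Notation S := (den_set D).

Let S1 : S 1. Proof. by have [[[]]] := den_axiom D. Qed.
Let S0 : ~ S 0. Proof. by have [[[]]] := den_axiom D. Qed.
Let SM s t : S s -> S t -> S (s * t).
Proof. by have [[[_ _ +] _] _] := den_axiom D; apply. Qed.
Let SO r s : S s -> exists s' r', S s' /\ s' * r = r' * s.
Proof. by have [[_ +] _] := den_axiom D; apply. Qed.
Let SD x y s : S s -> x * s = y * s -> exists2 t, S t & t * x = t * y.
Proof.
have [_ H] := den_axiom D => Ss e.
have [|t St te] := H (x - y) s Ss; first by rewrite mulrBl e subrr.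
by exists t => //; apply/eqP; rewrite -subr_eq0 -mulrBr te.
Qed.

Definition denom := {s : R | `[< S s >]}.
Definition denom1 : denom := exist _ 1 (introT (asboolP (S 1)) S1).

HB.instance Definition _ := Choice.on denom.

(* (s, r) ~ (s', r') when a s = b s' in S and a r = b r' for some a, b *)
Definition frac_rel (p q : R * R) :=
  exists a b, [/\ S (a * p.1), a * p.1 = b * q.1 & a * p.2 = b * q.2].

Lemma frac_rel_refl p : S p.1 -> frac_rel p p.
Proof. by move=> Sp; exists 1, 1; rewrite mul1r. Qed.

Lemma frac_rel_sym p q : frac_rel p q -> frac_rel q p.
Proof. by move=> [a [b [Sa e e']]]; exists b, a; rewrite -e e'. Qed.

Lemma frac_rel_trans q p r : frac_rel p q -> frac_rel q r -> S q.1 ->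
  frac_rel p r.
Proof.
case: p q r => [s r] [s' r'] [s'' r''] /= [a [b [/= Sa e1 e2]]].
move=> [c [d [/= Sc e3 e4]]] Ss'.
have [p [q [Sp e]]] := SO (b * s') Sc.
have [t St te] : exists2 t, S t & t * (p * b) = t * (q * c).
  by apply: (SD Ss'); rewrite -!mulrA.
exists (t * (p * a)), (t * (q * d)) => /=; split.
- by rewrite -!mulrA; do 2![apply: SM => //].
- by rewrite -!mulrA e1 e e3.
- by rewrite -!mulrA e2 -e4 !mulrA -(mulrA t p) te !mulrA.
Qed.

Definition frac_equiv (p q : denom * R) : bool :=
  `[< frac_rel (val p.1, p.2) (val q.1, q.2) >].

Lemma denomP (s : denom) : S (val s). Proof. by apply/asboolP; case: s. Qed.

Lemma frac_equiv_class : equiv_class_of frac_equiv.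
Proof.
split=> [p|p q|q p r].
- by apply/asboolP/frac_rel_refl/denomP.
- by apply/asboolP/asboolP; apply: frac_rel_sym.
- move=> /asboolP pq /asboolP qr; apply/asboolP.
  by apply: frac_rel_trans pq qr _; apply: denomP.
Qed.

Canonical frac_equiv_rel := EquivRelPack frac_equiv_class.

Local Open Scope quotient_scope.

Definition localization := {eq_quot frac_equiv}.

HB.instance Definition _ := Choice.on localization.

Definition frac (s r : R) : localization :=
  \pi_localization (insubd denom1 s, r).

Lemma frac_eq s r s' r' : S s -> S s' ->
  frac s r = frac s' r' <-> frac_rel (s, r) (s', r').
Proof.
move=> Ss Ss'.
have vK u : S u -> val (insubd denom1 u) = u.
  by move=> Su; rewrite insubdK //; apply/asboolP.
have E : (frac s r == frac s' r') = `[< frac_rel (s, r) (s', r') >].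
  by rewrite /frac eqmodE /= /frac_equiv /= !vK.
by split=> [/eqP|H]; [rewrite E => /asboolP | apply/eqP; rewrite E; apply/asboolP].
Qed.

Lemma frac_surj (q : localization) : exists s r, S s /\ q = frac s r.
Proof.
case e: (repr q) => [s r]; exists (val s), r; split; first exact: denomP.
by rewrite -[q]reprK e /frac valKd.
Qed.

Lemma frac_expand a s r : S s -> S (a * s) -> frac s r = frac (a * s) (a * r).
Proof.
by move=> Ss Sas; apply/frac_eq => //; exists a, 1; rewrite !mul1r.
Qed.

Lemma frac_common (p q : localization) :
  exists s r r', [/\ S s, p = frac s r & q = frac s r'].
Proof.
have [s [r [Ss ->]]] := frac_surj p; have [s' [r' [Ss' ->]]] := frac_surj q.
have [a [b [Sa e]]] := SO s Ss'.
have Sas : S (a * s) by apply: SM.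
exists (a * s), (a * r), (b * r'); split=> //; first exact: frac_expand.
by rewrite e; apply: frac_expand => //; rewrite -e.
Qed.

Lemma frac_common3 (p q o : localization) : exists s r r' r'',
  [/\ S s, p = frac s r, q = frac s r' & o = frac s r''].
Proof.
have [s [r [r' [Ss -> ->]]]] := frac_common p q.
have [t [u [St ->]]] := frac_surj o.
have [a [b [Sa e]]] := SO s St.
have Sas : S (a * s) by apply: SM.
exists (a * s), (a * r), (a * r'), (b * u); split=> //; try exact: frac_expand.
by rewrite e; apply: frac_expand => //; rewrite -e.
Qed.

Lemma frac_same s r r' : S s ->
  frac s r = frac s r' <-> exists2 t, S t & t * r = t * r'.
Proof.
move=> Ss; split=> [/frac_eq-/(_ Ss Ss)[a [b [/= Sa e e']]]|[t St e]].
  have [t St te] := SD Ss e.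
  have [p [q [Sp pq]]] := SO s (SM St Sa).
  have [m Sm me] : exists2 m, S m & m * p = m * (q * (t * a)).
    by apply: (SD Ss); rewrite -!mulrA.
  exists (m * p); first exact: SM.
  by rewrite me {2}te -!mulrA e'.
by apply/frac_eq => //; exists t, t; split=> //; apply: SM.
Qed.

(* s^-1 r + s^-1 r' = s^-1 (r + r') *)
Lemma frac_add_ex (p q : localization) : exists o, exists s r r',
  [/\ S s, p = frac s r, q = frac s r' & o = frac s (r + r')].
Proof.
have [s [r [r' [Ss -> ->]]]] := frac_common p q.
by exists (frac s (r + r')), s, r, r'.
Qed.

Definition loc_add p q : localization := projT1 (cid (frac_add_ex p q)).

Lemma loc_addE s r r' : S s ->
  loc_add (frac s r) (frac s r') = frac s (r + r').
Proof.
move=> Ss; rewrite /loc_add; case: cid => _ /= [u [x [y [Su e1 e2 ->]]]].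
have [a [b [Sa ab]]] := SO s Su.
have Sas : S (a * s) by apply: SM.
have Sbu : S (b * u) by rewrite -ab.
move: e1 e2; rewrite !(frac_expand _ Ss Sas) !(frac_expand _ Su Sbu) -!ab.
move=> /frac_same-/(_ Sas)[t St te] /frac_same-/(_ Sas)[t' St' te'].
apply/esym/frac_same => //; rewrite !mulrDr.
have [c [d [Sc cd]]] := SO t St'.
exists (c * t); first exact: SM.
by rewrite !mulrDr -(mulrA c) te cd -!(mulrA d) te' !mulrA cd.
Qed.

(* (s^-1 r) (t^-1 u) = (s' s)^-1 (r' u) whenever s' r = r' t *)
Lemma frac_mul_ex (p q : localization) : exists o, exists s r t u s' r',
  [/\ S s /\ S t, p = frac s r, q = frac t u,
      S s' /\ s' * r = r' * t & o = frac (s' * s) (r' * u)].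
Proof.
have [s [r [Ss ->]]] := frac_surj p; have [t [u [St ->]]] := frac_surj q.
have [s' [r' [Ss' e]]] := SO r St.
by exists (frac (s' * s) (r' * u)), s, r, t, u, s', r'.
Qed.

Definition loc_mul p q : localization := projT1 (cid (frac_mul_ex p q)).

Lemma frac_mul_uniq a s r t u s' r' s1 r1 :
  S s -> S t -> S (a * s) -> S s' -> s' * (a * r) = r' * t ->
  S s1 -> s1 * r = r1 * t ->
  frac (s' * (a * s)) (r' * u) = frac (s1 * s) (r1 * u).
Proof.
move=> Ss St Sas Ss' e Ss1 e1.
have [p [q [Sp pq]]] := SO (s' * (a * s)) (SM Ss1 Ss).
have [m Sm me] : exists2 m, S m & m * (p * s' * a) = m * (q * s1).
  by apply: (SD Ss); rewrite -!mulrA.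
have [n Sn ne] : exists2 n, S n & n * (m * p * r') = n * (m * q * r1).
  apply: (SD St); rewrite -!mulrA -e -e1 !mulrA.
  by rewrite -(mulrA _ s') -(mulrA m) !mulrA; move: me; rewrite !mulrA => ->.
have Sl : S (n * m * p * (s' * (a * s))) by do ![apply: SM => //].
have El : n * m * p * (s' * (a * s)) = n * m * q * (s1 * s).
  by rewrite -!mulrA pq.
rewrite (@frac_expand (n * m * p) (s' * (a * s))) ?(@frac_expand (n * m * q) (s1 * s)) -?El //;
  do ?[exact: SM].
by congr frac; move: ne; rewrite !mulrA => ->.
Qed.

Lemma loc_mulE s r t u s' r' : S s -> S t -> S s' -> s' * r = r' * t ->
  loc_mul (frac s r) (frac t u) = frac (s' * s) (r' * u).
Proof.
move=> Ss St Ss' e; rewrite /loc_mul.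
case: cid => _ /= [s1 [r1 [t1 [u1 [s2 [r2 [[Ss1 St1] es et [Ss2 e2] ->]]]]]]].
move: es => /frac_eq-/(_ Ss Ss1)[a [b [/= Sas as_ ar]]].
move: et => /frac_eq-/(_ St St1)[c [d [/= Sct ct cu]]].
have Sbs : S (b * s1) by rewrite -as_.
have Sdt : S (d * t1) by rewrite -ct.
have [s3 [r3 [Ss3 e3]]] := SO (a * r) Sct.
have e4 : s3 * (a * r) = r3 * c * t by rewrite e3 mulrA.
have e5 : s3 * (b * r1) = r3 * d * t1 by rewrite -ar e3 ct mulrA.
rewrite -(frac_mul_uniq u Ss St Sas Ss3 e4 Ss' e).
rewrite -(frac_mul_uniq u1 Ss1 St1 Sbs Ss3 e5 Ss2 e2).
by rewrite -as_ -!mulrA cu.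
Qed.

Definition loc_opp (p : localization) : localization :=
  loc_mul (frac 1 (-1)) p.

Lemma loc_oppE s r : S s -> loc_opp (frac s r) = frac s (- r).
Proof.
move=> Ss; rewrite /loc_opp (@loc_mulE _ _ _ _ s (-1)) //.
  by rewrite mulr1 mulN1r.
by rewrite mulrN1 mulN1r.
Qed.

Lemma frac0 s : S s -> frac s 0 = frac 1 0.
Proof. by move=> Ss; apply/frac_eq => //; exists 1, s; rewrite mul1r !mulr0 mulr1. Qed.

Lemma frac1 s : S s -> frac s s = frac 1 1.
Proof. by move=> Ss; apply/frac_eq => //; exists 1, s; rewrite mul1r !mulr1. Qed.

Lemma loc_addA : associative loc_add.
Proof.
move=> p q o; have [s [x [y [z [Ss -> -> ->]]]]] := frac_common3 p q o.
by rewrite !loc_addE // addrA.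
Qed.

Lemma loc_addC : commutative loc_add.
Proof.
move=> p q; have [s [x [y [Ss -> ->]]]] := frac_common p q.
by rewrite !loc_addE // addrC.
Qed.

Lemma loc_add0 : left_id (frac 1 0) loc_add.
Proof.
move=> p; have [s [x [Ss ->]]] := frac_surj p.
by rewrite -(frac0 Ss) loc_addE // add0r.
Qed.

Lemma loc_addN : left_inverse (frac 1 0) loc_opp loc_add.
Proof.
move=> p; have [s [x [Ss ->]]] := frac_surj p.
by rewrite loc_oppE // loc_addE // addNr frac0.
Qed.

Lemma loc_mulA : associative loc_mul.
Proof.
move=> p q o; have [s [r [Ss ->]]] := frac_surj p.
have [t [u [St ->]]] := frac_surj q; have [v [w [Sv ->]]] := frac_surj o.
have [t1 [u1 [St1 e1]]] := SO u Sv.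
have [s2 [r2 [Ss2 e2]]] := SO r (SM St1 St).
rewrite (loc_mulE w St Sv St1 e1) (loc_mulE _ Ss (SM St1 St) Ss2 e2).
rewrite (@loc_mulE s r t u s2 (r2 * t1)) -?mulrA //.
rewrite (@loc_mulE _ _ v w 1 (r2 * u1)) ?mul1r ?mulrA //; first exact: SM.
by rewrite -mulrA e1 mulrA.
Qed.

Lemma loc_mul1r : left_id (frac 1 1) loc_mul.
Proof.
move=> p; have [s [r [Ss ->]]] := frac_surj p.
by rewrite (@loc_mulE _ _ _ _ s 1) ?mulr1 ?mul1r.
Qed.

Lemma loc_mulr1 : right_id (frac 1 1) loc_mul.
Proof.
move=> p; have [s [r [Ss ->]]] := frac_surj p.
by rewrite (@loc_mulE _ _ _ _ 1 r) ?mulr1 ?mul1r.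
Qed.

Lemma loc_mulDl : left_distributive loc_mul loc_add.
Proof.
move=> p q o; have [s [x [y [Ss -> ->]]]] := frac_common p q.
have [t [u [St ->]]] := frac_surj o.
have [a [b [Sa ab]]] := SO x St.
have [c [d [Sc cd]]] := SO (a * y) St.
have Sca : S (c * a) by apply: SM.
have ex : c * a * x = c * b * t by rewrite -mulrA ab mulrA.
have ey : c * a * y = d * t by rewrite -mulrA.
rewrite loc_addE // (loc_mulE u Ss St Sca ex) (loc_mulE u Ss St Sca ey).
rewrite loc_addE; last exact: SM.
by rewrite (@loc_mulE _ _ _ _ (c * a) (c * b + d)) ?mulrDl // mulrDr ex ey.
Qed.

Lemma loc_mulDr : right_distributive loc_mul loc_add.
Proof.
move=> o p q; have [s [x [y [Ss -> ->]]]] := frac_common p q.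
have [t [u [St ->]]] := frac_surj o.
have [a [b [Sa ab]]] := SO u Ss.
rewrite loc_addE // !(loc_mulE _ St Ss Sa ab) loc_addE ?mulrDr //.
exact: SM.
Qed.

Lemma loc_1neq0 : frac 1 1 != frac 1 0.
Proof.
apply/eqP => /frac_same-/(_ S1)[t St].
by rewrite mulr1 mulr0 => t0; apply: S0; rewrite -t0.
Qed.

HB.instance Definition _ := GRing.isZmodule.Build localization
  loc_addA loc_addC loc_add0 loc_addN.
HB.instance Definition _ := GRing.Zmodule_isNzRing.Build localization
  loc_mulA loc_mul1r loc_mulr1 loc_mulDl loc_mulDr loc_1neq0.

Definition to_localization (r : R) : localization := frac 1 r.

Lemma to_localization_zmod : zmod_morphism to_localization.
Proof.
move=> x y; rewrite /to_localization.
have -> : - frac 1 y = frac 1 (- y) by apply: loc_oppE.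
by symmetry; apply: loc_addE.
Qed.

Lemma to_localization_monoid : monoid_morphism to_localization.
Proof.
split=> // x y; symmetry; rewrite /to_localization.
have -> : frac 1 x * frac 1 y = loc_mul (frac 1 x) (frac 1 y) by [].
by rewrite (@loc_mulE _ _ _ _ 1 x) ?mulr1 ?mul1r.
Qed.

HB.instance Definition _ := GRing.isZmodMorphism.Build R localization
  to_localization to_localization_zmod.
HB.instance Definition _ := GRing.isMonoidMorphism.Build R localization
  to_localization to_localization_monoid.

Lemma to_localization_ker r : to_localization r = 0 <-> ass S r.
Proof.
split=> [/frac_same-/(_ S1)[t St]|[t St e]]; first by rewrite mulr0; exists t.
by apply/frac_same => //; exists t; rewrite // mulr0.
Qed.

Lemma to_localization_unit s : S s -> units localization (to_localization s).
Proof.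
move=> Ss; exists (frac s 1).
have E p q : p * q = loc_mul p q by [].
split; rewrite E.
  by rewrite (@loc_mulE _ _ _ _ 1 1) ?mul1r ?mulr1.
by rewrite (@loc_mulE _ _ _ _ 1 1) ?mul1r ?mulr1 // frac1.
Qed.

Lemma fracE s r : S s -> to_localization s * frac s r = to_localization r.
Proof.
move=> Ss.
have -> : to_localization s * frac s r = loc_mul (frac 1 s) (frac s r) by [].
by rewrite (@loc_mulE _ _ _ _ 1 1) ?mul1r ?mulr1.
Qed.

End Localization.

Section QuotientRings.
Variable R : nzRingType.

Lemma regular_left_Ore_Den (S : set R) :
  S `<=` regular_elements R -> left_Ore S -> Den_l R S.
Proof.
move=> Sreg SO; split=> // r s /Sreg[_ reg] /reg ->.
by exists 1; [have [[]] := SO | rewrite mulr0].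
Qed.

Lemma ass0_regular (S : set R) : Den_l R S -> ass S = [set 0] ->
  S `<=` regular_elements R.
Proof.
move=> [_ SD] S0 s Ss; split=> r e.
  have : ass S r by exists s.
  by rewrite S0.
have [t St tr] := SD r s Ss e; have : ass S r by exists t.
by rewrite S0.
Qed.

(* "Q_{l,cl}(R) exists" means [left_Ore (regular_elements R)]; the ring
   Q_{l,cl}(R) is then [Q_lcl H]. *)
Definition Q_lcl (H : left_Ore (regular_elements R)) : nzRingType :=
  localization (DenSet (regular_left_Ore_Den (@subset_refl _ _) H)).

Definition S_l0_set : set R :=
  \bigcup_(S in [set S | Den_l R S /\ ass S = [set 0]]) S.

Inductive S_l0_gen : R -> Prop :=
| S_l0_gen1 : S_l0_gen 1
| S_l0_genM s t : S_l0_set s -> S_l0_gen t -> S_l0_gen (s * t).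

Lemma S_l0_gen_Den : Den_l R S_l0_gen /\ ass S_l0_gen = [set 0].
Proof.
have genS S s : Den_l R S -> ass S = [set 0] -> S s -> S_l0_gen s.
  move=> DS S0 Ss; rewrite -[s]mulr1; apply: S_l0_genM S_l0_gen1.
  by exists S.
have reg s : S_l0_gen s -> regular_elements R s.
  elim=> [|{}s t [S [DS S0] Ss] _ [IHl IHr]].
    by split=> r; rewrite ?mul1r ?mulr1.
  have [sl sr] := ass0_regular DS S0 Ss.
  split=> r; first by rewrite -mulrA => /sl/IHl.
  by rewrite mulrA => /IHr/sr.
have mul s t : S_l0_gen s -> S_l0_gen t -> S_l0_gen (s * t).
  move=> Gs Gt; elim: Gs => [|{}s u Ss _ IH]; first by rewrite mul1r.
  by rewrite -mulrA; apply: S_l0_genM.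
split; last first.
  apply/seteqP; split=> [r [s /reg[+ _]]|_ ->]; first by move=> /[apply].
  by exists 1; [exact: S_l0_gen1 | rewrite mulr0].
apply: regular_left_Ore_Den => //; split; first split=> //.
- exact: S_l0_gen1.
- by move=> /reg[+ _] => /(_ 1); rewrite mul0r => /(_ erefl)/eqP; rewrite oner_eq0.
- move=> r s Gs; elim: Gs r => [r|{}s t [S [DS S0] Ss] _ IH r].
    by exists 1, r; split; [exact: S_l0_gen1 | rewrite mul1r mulr1].
  have [t' [r' [Gt' e]]] := IH r.
  have [[_ SO] _] := DS.
  have [s' [r'' [Ss' e']]] := SO r' s Ss.
  exists (s' * t'), r''; split; first by apply: mul => //; apply: genS Ss'.
  by rewrite -mulrA e mulrA e' mulrA.
Qed.

Lemma S_l0_Den : Den_l R S_l0_set /\ ass S_l0_set = [set 0].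
Proof.
suff -> : S_l0_set = S_l0_gen by exact: S_l0_gen_Den.
apply/seteqP; split=> s Ss.
  by rewrite -[s]mulr1; apply: S_l0_genM S_l0_gen1.
by exists S_l0_gen => //; exact: S_l0_gen_Den.
Qed.

Lemma S_l0_largest (S : set R) : Den_l R S -> ass S = [set 0] -> S `<=` S_l0_set.
Proof. by move=> DS S0 s Ss; exists S. Qed.

Definition S_l0 : denSet R := DenSet S_l0_Den.1.

Definition Q_l : nzRingType := localization S_l0.

End QuotientRings.

(* The direct product of a finite family of rings; it is the zero ring when
   n = 0, hence a [pzRingType]. *)
Section ProductRing.
Variables (n : nat) (R_ : 'I_n -> nzRingType).

Definition prod_ring := forall i, R_ i.

HB.instance Definition _ := Choice.on prod_ring.

Implicit Types f g : prod_ring.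

Definition prod_add f g : prod_ring := fun i => f i + g i.
Definition prod_opp f : prod_ring := fun i => - f i.
Definition prod_mul f g : prod_ring := fun i => f i * g i.
Definition prod_zero : prod_ring := fun=> 0.
Definition prod_one : prod_ring := fun=> 1.

Lemma prod_addA : associative prod_add.
Proof. by move=> f g h; apply: functional_extensionality_dep => i; apply: addrA. Qed.
Lemma prod_addC : commutative prod_add.
Proof. by move=> f g; apply: functional_extensionality_dep => i; apply: addrC. Qed.
Lemma prod_add0 : left_id prod_zero prod_add.
Proof. by move=> f; apply: functional_extensionality_dep => i; apply: add0r. Qed.
Lemma prod_addN : left_inverse prod_zero prod_opp prod_add.
Proof. by move=> f; apply: functional_extensionality_dep => i; apply: addNr. Qed.
Lemma prod_mulA : associative prod_mul.
Proof. by move=> f g h; apply: functional_extensionality_dep => i; apply: mulrA. Qed.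
Lemma prod_mul1r : left_id prod_one prod_mul.
Proof. by move=> f; apply: functional_extensionality_dep => i; apply: mul1r. Qed.
Lemma prod_mulr1 : right_id prod_one prod_mul.
Proof. by move=> f; apply: functional_extensionality_dep => i; apply: mulr1. Qed.
Lemma prod_mulDl : left_distributive prod_mul prod_add.
Proof. by move=> f g h; apply: functional_extensionality_dep => i; apply: mulrDl. Qed.
Lemma prod_mulDr : right_distributive prod_mul prod_add.
Proof. by move=> f g h; apply: functional_extensionality_dep => i; apply: mulrDr. Qed.

HB.instance Definition _ := GRing.isZmodule.Build prod_ring
  prod_addA prod_addC prod_add0 prod_addN.
HB.instance Definition _ := GRing.Zmodule_isPzRing.Build prod_ring
  prod_mulA prod_mul1r prod_mulr1 prod_mulDl prod_mulDr.

End ProductRing.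

Definition ring_isomorphic (A B : pzRingType) :=
  exists f : {rmorphism A -> B}, bijective f.

Definition iso_product_of_local_rad_nil (Q : nzRingType) :=
  exists (n : nat) (R_ : 'I_n -> nzRingType),
    [/\ (1 <= n)%N,
        ring_isomorphic Q (prod_ring R_),
        forall i, local_ring (R_ i)
      & forall i, jacobson_radical (R_ i) = nil_radical (R_ i)].

(* Main.v *)
Require Import Defs.
From HB Require Import structures.
From mathcomp Require Import all_boot all_algebra.
From mathcomp Require Import boolp classical_sets functions cardinality.

(* A ring is local with nil Jacobson radical equal to its nil radical iff each
   of its elements is a unit or nilpotent; and if S is a maximal left
   denominator set of R, then S is the pullback of the units of S^-1 R, in which
   the left localizable elements are exactly the units. So condition (c) says
   that the rings S^-1 R are of this kind.

   All three statements thus concern an injective map f : R' -> prod_i Q_i into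
   a finite product of such rings, each element of which is t^-1 r with f t a
   unit. An element of R' with a non-unit, hence nilpotent, component is a zero
   divisor, so the regular elements are those sent to units, and the product is
   both Q_l(R') and Q_lcl(R'). The maximal denominator sets of R' are the
   pullbacks of the units of the factors: a denominator set in none of these
   contains an element with i-th component 0 for each i, and their product is 0.

   From 1, take Q_i = S_i^-1 R: by (d) there are elements of S_j lying in
   ass S_i for all i <> j, and these clear denominators simultaneously.
   From 2, elements of R' with all components but one equal to 0 and the
   remaining one a unit are localizable, so they lift into maximal denominator
   sets of R, which gives (a) and (d). *)

Set Implicit Arguments.
Unset Strict Implicit.
Unset Printing Implicit Defensive.

Import GRing.Theory.
Local Open Scope classical_set_scope.
Local Open Scope ring_scope.

(** * Invertible elements *)

Section Invertible.
Variable Q : pzRingType.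

(** [units] again, over [pzRingType], so that it also applies to [prod_ring]. *)
Definition invertible : set Q := [set x | exists y, x * y = 1 /\ y * x = 1].

Definition unit_or_nilpotent :=
  forall x : Q, invertible x \/ exists n, x ^+ n = 0.

Lemma invertible1 : invertible 1.
Proof. by exists 1; rewrite mulr1. Qed.

Lemma invertibleM x y : invertible x -> invertible y -> invertible (x * y).
Proof.
move=> [a [xa ax]] [b [yb by_]]; exists (b * a); split.
  by rewrite mulrA -(mulrA x) yb mulr1.
by rewrite mulrA -(mulrA b) ax mulr1.
Qed.

Lemma invertible_lreg u x y : invertible u -> u * x = u * y -> x = y.
Proof.
by move=> [v [_ vu]] e; rewrite -[x]mul1r -vu -mulrA e mulrA vu mul1r.
Qed.

Lemma invertible_rreg u x y : invertible u -> x * u = y * u -> x = y.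
Proof.
by move=> [v [uv _]] e; rewrite -[x]mulr1 -uv mulrA e -mulrA uv mulr1.
Qed.

Lemma invertible_mulKl u x : invertible u -> invertible (u * x) -> invertible x.
Proof.
move=> [v [uv vu]] ux.
have -> : x = v * (u * x) by rewrite mulrA vu mul1r.
by apply: invertibleM => //; exists u.
Qed.

Lemma expr0_lreg (u : Q) n : (forall x, u * x = 0 -> x = 0) ->
  u ^+ n = 0 -> (1 : Q) = 0.
Proof.
by move=> reg; elim: n => [|n IH]; rewrite ?expr0 // exprS => /reg/IH.
Qed.

Lemma expr0_rreg (u : Q) n : (forall x, x * u = 0 -> x = 0) ->
  u ^+ n = 0 -> (1 : Q) = 0.
Proof.
by move=> reg; elim: n => [|n IH]; rewrite ?expr0 // exprSr => /reg/IH.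
Qed.

(** The inverse is the geometric series [g]; it commutes with [x - 1], so one factorization gives
    both sides. *)
Lemma invertible_subr_nilp (x : Q) n : x ^+ n = 0 -> invertible (1 - x).
Proof.
move=> xn0; have e := subrX1 x n; rewrite xn0 sub0r in e.
set g := \sum_(i < n) x ^+ i in e.
have gx : GRing.comm g (x - 1).
  apply: commrB; last exact: commr1.
  apply/commr_sym/commr_sum => i _; exact: commrX.
exists g; split; first by rewrite -opprB mulNr -e opprK.
by rewrite -opprB mulrN gx -e opprK.
Qed.

End Invertible.

Lemma rmorph_invertible (P Q : pzRingType) (f : {rmorphism P -> Q}) x :
  invertible x -> invertible (f x).
Proof.
by move=> [y [xy yx]]; exists (f y); rewrite -!rmorphM xy yx rmorph1.
Qed.

(** * Local rings whose radical is nil *)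

Section UnitOrNilpotent.
Variable R : nzRingType.

Lemma invertible_not_nilp (x : R) n : invertible x -> x ^+ n <> 0.
Proof.
move=> ux xn0; have /eqP : (1 : R) = 0.
  apply: expr0_lreg xn0 => y e; apply: (invertible_lreg ux).
  by rewrite e mulr0.
by rewrite oner_eq0.
Qed.

Lemma not_invertible0 : ~ invertible (0 : R).
Proof. by move/(@invertible_not_nilp _ 1)/(_ (expr1 _)). Qed.

(** Proper left ideals contain no units, so the ideal of non-units is the only maximal left
    ideal. *)
Lemma local_jacobson : local_ring R -> jacobson_radical R = ~` units R.
Proof.
move=> loc; have [[I0 ID Il] Ir] := loc.
have sub J : is_left_ideal J -> J <> setT -> J `<=` ~` units R.
  move=> [J0 JD JM] JT x Jx [y [xy yx]]; apply: JT.
  apply/seteqP; split=> // z _.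
  by rewrite -[z]mulr1 -yx mulrA; apply: JM.
have nT : ~` units R <> setT.
  by move=> e; have : (~` units R) 1 by [rewrite e]; apply; exact: invertible1.
have maxI : maximal_left_ideal R (~` units R).
  split=> // J JI IJ; have [->|/sub sJ] := pselect (J = setT); first by right.
  by left; apply/seteqP; split=> //; exact: sJ.
apply/seteqP; split=> [x /(_ _ maxI)//|x nx M [MI MT Mmax]].
by have [e|e] := Mmax _ (And3 I0 ID Il) (sub _ MI MT); [rewrite -e|case: nT].
Qed.

Lemma idealD (I J : set R) : is_ideal I -> is_ideal J ->
  is_ideal [set x + y | x in I & y in J].
Proof.
move=> [[I0 ID IM] IMr] [[J0 JD JM] JMr]; split; first split.
- by exists 0 => //; exists 0; rewrite ?addr0.
- move=> _ _ [x Ix [y Jy <-]] [x' Ix' [y' Jy' <-]].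
  exists (x + x'); first exact: ID.
  by exists (y + y'); [exact: JD | rewrite addrACA].
- move=> a _ [x Ix [y Jy <-]]; exists (a * x); first exact: IM.
  by exists (a * y); [exact: JM | rewrite mulrDr].
- move=> a _ [x Ix [y Jy <-]]; exists (x * a); first exact: IMr.
  by exists (y * a); [exact: JMr | rewrite mulrDl].
Qed.

(** Modulo [J] the powers of [x + y] are those of [x]; hence some power lies in [J] and is
    nilpotent. *)
Lemma nil_idealD (I J : set R) : is_nil_ideal I -> is_nil_ideal J ->
  is_nil_ideal [set x + y | x in I & y in J].
Proof.
move=> [Ii In] [Ji Jn]; split; first exact: idealD.
have [[_ JD JM] JMr] := Ji => _ [x Ix [y Jy <-]]; have [n xn0] := In x Ix.
have [z Jz e] : exists2 z, J z & (x + y) ^+ n = x ^+ n + z.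
  elim: n {xn0} => [|n [z Jz e]].
    by exists 0; rewrite ?addr0 //; case: Ji => -[].
  exists (x * z + y * (x ^+ n + z)); last first.
    by rewrite exprS e mulrDl mulrDr -exprS addrA.
  by apply: JD; [exact: JM | exact: JMr].
have [k zk0] := Jn z Jz; exists (n * k)%N.
by rewrite exprM e xn0 add0r.
Qed.

Lemma nil_radical_nil : nil_radical R `<=` nilpotent_elements R.
Proof.
move=> _ [s [sI ->]].
suff [I [[_ In] Is]] : exists I, is_nil_ideal I /\ I (\sum_(y <- s) y).
  exact: In.
elim: s sI => [|y s IH] sI.
  exists [set 0]; rewrite big_nil; split=> //.
  split; last by move=> _ ->; exists 1%N.
  split; last by move=> a x ->; rewrite mul0r.
  by split=> [//|x y -> ->|a x ->]; rewrite ?addr0 ?mulr0.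
have [J [Jn Jy]] := sI y (mem_head _ _).
have [|I [In Is]] := IH; first by move=> z zs; apply: sI; rewrite inE zs orbT.
exists [set x + y | x in J & y in I]; split; first exact: nil_idealD.
by rewrite big_cons; exists y => //; exists (\sum_(y <- s) y).
Qed.

(** A nilpotent element cannot divide a unit, since cancelling its powers would give 1 = 0. For
    sums, [b * (x + y) = 1] with [b * x] nilpotent makes [b * y = 1 - b * x] invertible. *)
Lemma unit_or_nilpotentP :
  unit_or_nilpotent R <->
  local_ring R /\ jacobson_radical R = nil_radical R.
Proof.
split=> [UN|[loc rad] x]; last first.
  have [|nx] := pselect (invertible x); first by left.
  by right; apply: nil_radical_nil; rewrite -rad local_jacobson.
have nilp (x : R) : ~ invertible x -> exists n, x ^+ n = 0 by case: (UN x).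
have nM (x a : R) : ~ invertible x ->
    ~ invertible (a * x) /\ ~ invertible (x * a).
  move=> /nilp[n xn0]; split=> -[b [abx bax]].
    have /eqP : (1 : R) = 0.
      apply: expr0_lreg xn0 => z xz.
      by rewrite -[z]mul1r -bax -!mulrA xz !mulr0.
    by rewrite oner_eq0.
  have /eqP : (1 : R) = 0.
    apply: expr0_rreg xn0 => z xz.
    by rewrite -[z]mulr1 -abx !mulrA xz !mul0r.
  by rewrite oner_eq0.
have loc : local_ring R.
  split; last by move=> a x /(nM _ a)[].
  split; [exact: not_invertible0 | | by move=> a x /(nM _ a)[]].
  move=> x y nx ny [b [xyb bxy]].
  have [/nilp[n bxn0] _] := nM x b nx.
  have [nby _] := nM y b ny; apply: nby.
  have -> : b * y = 1 - b * x by rewrite -bxy mulrDr addrAC subrr add0r.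
  exact: invertible_subr_nilp bxn0.
split=> //; rewrite local_jacobson //; apply/seteqP; split=> x.
  move=> nx; exists [:: x]; rewrite big_seq1; split=> // y.
  rewrite inE => /eqP ->; by exists (~` units R).
move=> /nil_radical_nil[n xn0] ux; exact: invertible_not_nilp ux xn0.
Qed.

End UnitOrNilpotent.

(** * Pullbacks of units along ring morphisms *)

Section RingPullback.
Variables (R : nzRingType) (Q : pzRingType) (f : {rmorphism R -> Q}).

Lemma pullback_units_multiplicative :
  (1 : Q) <> 0 -> Defs.multiplicative [set t | invertible (f t)].
Proof.
move=> Q10; split=> /= [||s t]; rewrite ?rmorph1 ?rmorph0 ?rmorphM.
- exact: invertible1.
- by move=> [y [e _]]; apply: Q10; rewrite -e mul0r.
- exact: invertibleM.
Qed.

(** The hypotheses say that [f] behaves like a localization map. For the Ore condition, [f r] times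
    the inverse of [f s] is written as a left fraction, and [u] clears the discrepancy in the
    kernel. *)
Lemma pullback_units_Den :
  (1 : Q) <> 0 ->
  (forall q, exists t r, invertible (f t) /\ f t * q = f r) ->
  (forall r, f r = 0 -> exists2 t, invertible (f t) & t * r = 0) ->
  Den_l R [set t | invertible (f t)].
Proof.
move=> Q10 dense ker; have [T1 T0 TM] := pullback_units_multiplicative Q10.
have key r s : invertible (f s) -> r * s = 0 -> f r = 0.
  move=> us rs; apply: (invertible_rreg us).
  by rewrite -rmorphM rs rmorph0 mul0r.
split; last by move=> r s us /key-/(_ us)/ker.
split=> // r s [v [sv vs]].
have [t [a [ut e]]] := dense (f r * v).
have [u uu ue] : exists2 u, invertible (f u) & u * (t * r - a * s) = 0.
  by apply: ker; rewrite rmorphB !rmorphM -e -!mulrA vs mulr1 subrr.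
exists (u * t), (u * a); split; first exact: TM.
by apply/eqP; rewrite -subr_eq0 -!mulrA -mulrBr ue.
Qed.

End RingPullback.

(** * Maximal denominator sets *)

Section Maximal.
Variable R : nzRingType.
Implicit Types S T : set R.

Lemma Den_chain_union (F : set (set R)) : F !=set0 -> F `<=` Den_l R ->
  total_on F subset -> Den_l R (\bigcup_(S in F) S).
Proof.
move=> [B FB] FD Ftot; have D S : F S -> left_denominator S by apply: FD.
split; [split; [split|]|].
- by exists B => //; have [[[]]] := D B FB.
- by move=> [S FS S0]; have [[[]]] := D S FS.
- move=> s t [S FS Ss] [T FT Tt].
  have [ST|TS] := Ftot _ _ FS FT.
    exists T => //; have [[[_ _ TM] _] _] := D T FT.
    by apply: TM => //; apply: ST.
  exists S => //; have [[[_ _ SM] _] _] := D S FS.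
  by apply: SM => //; apply: TS.
- move=> r s [S FS Ss]; have [[_ SO] _] := D S FS.
  by have [s' [r' [Ss' e]]] := SO r s Ss; exists s', r'; split=> //; exists S.
- move=> r s [S FS Ss] rs; have [_ SD] := D S FS.
  by have [t St tr] := SD r s Ss rs; exists t => //; exists S.
Qed.

Lemma Den_sub_max S : Den_l R S -> exists2 M, max_Den_l R M & S `<=` M.
Proof.
(* Zorn is applied to the sets [A] to be joined to [S], so that the empty chain yields [S]
   itself. *)
move=> DS; have [|A [DA Amax]] := @Zorn_bigcup R (fun A => Den_l R (S `|` A)).
  move=> F FP Ftot; have [[B FB]|F0] := pselect (F !=set0); last first.
    rewrite bigcup0 ?setU0 // => A FA; by case: F0; exists A.
  have -> : S `|` \bigcup_(A in F) A = \bigcup_(A in [set S `|` A | A in F]) A.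
    rewrite bigcup_image; apply/seteqP; split=> x; last first.
      by move=> [A FA [Sx|Ax]]; [left|right; exists A].
    by move=> [Sx|[A FA Ax]]; [exists B => //; left | exists A => //; right].
  apply: Den_chain_union.
  - by exists (S `|` B), B.
  - by move=> _ [A FA <-]; apply: FP.
  - move=> _ _ [A FA <-] [C FC <-].
    by have [AC|CA] := Ftot _ _ FA FC; [left|right]; apply: setUS.
exists (S `|` A); last exact: subsetUl.
split=> // T DT; rewrite subUset => -[ST AT].
apply/seteqP; split=> [x Tx|x [/ST|/AT]//].
right; apply: contrapT => nAx; apply: (Amax T); last by rewrite (setUidr ST).
by split=> // /(_ x Tx).
Qed.

Lemma Den_ass_disjoint S s : Den_l R S -> S s -> ~ ass S s.
Proof.
by move=> [[[_ S0 SM] _] _] Ss [t St ts]; apply: S0; rewrite -ts; apply: SM.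
Qed.

Lemma Den_exp S s n : Den_l R S -> S s -> S (s ^+ n).
Proof.
move=> [[[S1 _ SM] _] _] Ss; elim: n => [|n IH]; first by rewrite expr0.
by rewrite exprS; apply: SM.
Qed.

End Maximal.

Lemma Den_units (R : nzRingType) : Den_l R (units R).
Proof.
have -> : units R = [set t | invertible (idfun t)] by [].
apply: pullback_units_Den => /= [|q|r ->].
- by apply/eqP; rewrite oner_eq0.
- by exists 1, q; rewrite mul1r; split=> //; apply: invertible1.
- by exists 1; rewrite ?mulr0 //; exact: invertible1.
Qed.

(** * Localization at a maximal denominator set *)

Section LocalizationFacts.
Variables (R : nzRingType) (D : denSet R).
Local Notation loc := (localization D).
Local Notation to_loc := (to_localization D).

Lemma localization_eq_fraction (q : loc) :
  exists s r, den_set D s /\ to_loc s * q = to_loc r.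
Proof.
by have [s [r [Ds ->]]] := frac_surj q; exists s, r; split; rewrite ?fracE.
Qed.

Lemma localization_common (p q : loc) : exists s r r',
  [/\ den_set D s, to_loc s * p = to_loc r & to_loc s * q = to_loc r'].
Proof.
have [s [r [r' [Ds -> ->]]]] := frac_common p q.
by exists s, r, r'; split; rewrite ?fracE.
Qed.

Lemma to_localization_eq x y : to_loc x = to_loc y ->
  exists2 t, den_set D t & t * x = t * y.
Proof.
move=> e; have : to_loc (x - y) = 0 by rewrite rmorphB /= e subrr.
move=> /to_localization_ker[t Dt te]; exists t => //.
by apply/eqP; rewrite -subr_eq0 -mulrBr te.
Qed.

Lemma pullback_localization_Den : Den_l R [set t | invertible (to_loc t)].
Proof.
apply: pullback_units_Den => [|q|r].
- by apply/eqP; rewrite oner_eq0.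
- have [s [r [Ds e]]] := localization_eq_fraction q.
  by exists s, r; split=> //; apply: to_localization_unit.
- move=> /to_localization_ker[t Dt tr]; exists t => //.
  exact: to_localization_unit.
Qed.

Lemma max_Den_units : max_Den_l R D ->
  den_set D = [set t | invertible (to_loc t)].
Proof.
move=> [_ Dmax]; symmetry; apply: Dmax; first exact: pullback_localization_Den.
by move=> s Ds; apply: to_localization_unit.
Qed.

(** Membership in a maximal [D] is decided by the image in [loc], where [y] vanishes. *)
Lemma max_Den_addr_ass x y : max_Den_l R D -> ass D y ->
  den_set D (x + y) -> den_set D x.
Proof.
move=> mD /to_localization_ker y0; rewrite (max_Den_units mD) /=.
by rewrite rmorphD /= y0 addr0.
Qed.

End LocalizationFacts.

Section MaximalLocalization.
Variables (R : nzRingType) (D : denSet R).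
Local Notation loc := (localization D).
Local Notation to_loc := (to_localization D).

(* A maximal T in [Den_l loc] contains the units, and the pullback of the units
   of its localization to R is a denominator set containing D. *)
Lemma localizable_unit (q : loc) : max_Den_l R D -> left_localizable loc q ->
  units loc q.
Proof.
move=> mD [T0 DT0 T0q]; have [T mT /(_ _ T0q) Tq] := Den_sub_max DT0.
have [DT _] := mT; pose E := DenSet DT.
pose g : {rmorphism R -> localization E} := to_localization E \o to_loc.
have g_unit s : den_set D s -> invertible (g s).
  move=> Ds; apply: (@rmorph_invertible _ _ (to_localization E)).
  exact: to_localization_unit.
have DP : Den_l R [set t | invertible (g t)].
  apply: pullback_units_Den => [|z|r gr0].
  - by apply/eqP; rewrite oner_eq0.
  - have [p [p' [Ep pz]]] := localization_eq_fraction z.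
    (* A common denominator in [D] for [p] and [p'] turns a fraction of fractions into one with both
       terms from [R]. *)
    have [s [r [r' [Ds sp sp']]]] := localization_common p p'.
    have gE : g r = g s * to_localization E p by rewrite /g /= -sp rmorphM.
    exists r, r'; split.
      rewrite gE; apply: invertibleM; first exact: g_unit.
      exact: to_localization_unit.
    by rewrite gE -mulrA pz /g /= -sp' rmorphM.
  - have /to_localization_ker[p Ep pr0] := gr0.
    have [s [a [Ds sp]]] := localization_eq_fraction p.
    have /to_localization_ker[t Dt tar] : to_loc (a * r) = 0.
      by rewrite rmorphM /= -sp -mulrA pr0 mulr0.
    exists (t * a); last by rewrite -mulrA.
    rewrite rmorphM; apply: invertibleM; first exact: g_unit.
    rewrite /= -sp rmorphM; apply: invertibleM; first exact: g_unit.
    exact: to_localization_unit.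
have PD : [set t | invertible (g t)] = den_set D.
  by have [_] := mD; apply=> //; exact: g_unit.
(* The numerator [a] of [q] becomes invertible under [g] because [q] is in [T]; hence [a] lies in
   [D]. *)
have [s [a [Ds sq]]] := localization_eq_fraction q.
have us : invertible (to_loc s) by apply: to_localization_unit.
apply: (invertible_mulKl us); rewrite sq; apply: to_localization_unit.
rewrite -PD /= /g /= -sq rmorphM; apply: invertibleM; first exact: g_unit.
exact: to_localization_unit.
Qed.

Lemma weakly_left_localizable_localization : max_Den_l R D ->
  weakly_left_localizable loc -> unit_or_nilpotent loc.
Proof.
move=> mD W x.
have [nx|/W/(localizable_unit mD)] := pselect (nilpotent_elements loc x).
  by right.
by left.
Qed.

End MaximalLocalization.

Lemma unit_or_nilpotent_wll (R : nzRingType) :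
  unit_or_nilpotent R -> weakly_left_localizable R.
Proof.
move=> UN r nr; exists (units R); first exact: Den_units.
by case: (UN r).
Qed.

(** * Universal properties of quotients and localizations *)

Lemma rmorphism_build (A B : pzRingType) (g : A -> B) :
  zmod_morphism g -> monoid_morphism g -> exists h : {rmorphism A -> B}, h =1 g.
Proof.
move=> gB gM.
pose mB := GRing.isZmodMorphism.Build A B g gB.
pose mM := GRing.isMonoidMorphism.Build A B g gM.
pose h : {rmorphism A -> B} := HB.pack g mB mM.
by exists h.
Qed.

Lemma quotient_lift (R : nzRingType) (J : properIdeal R) (Q : pzRingType)
    (f : {rmorphism R -> Q}) : (forall r, ideal_set J r -> f r = 0) ->
  exists g : {rmorphism quotient_ring J -> Q},
    forall r, g (to_quotient J r) = f r.
Proof.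
move=> fJ; pose g (p : quotient_ring J) : Q := f (repr p).
have gE r : g (to_quotient J r) = f r.
  apply/eqP; rewrite -subr_eq0 -rmorphB fJ //; apply/to_quotientP.
  by rewrite /to_quotient reprK.
have [||h hg] := @rmorphism_build _ _ g.
- move=> p q.
  have [x <-] := to_quotient_surj p; have [y <-] := to_quotient_surj q.
  by rewrite -rmorphB !gE rmorphB.
- split=> [|p q]; first by rewrite -(rmorph1 (to_quotient J)) gE rmorph1.
  have [x <-] := to_quotient_surj p; have [y <-] := to_quotient_surj q.
  by rewrite -rmorphM !gE rmorphM.
- by exists h => r; rewrite hg.
Qed.

Section LocalizationLift.
Variables (R : nzRingType) (D : denSet R) (Q : pzRingType).
Variable f : {rmorphism R -> Q}.
Hypothesis f_unit : forall s, den_set D s -> invertible (f s).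
Local Notation loc := (localization D).
Local Notation to_loc := (to_localization D).

(** Well-definedness is built in: one [z] serves all representations of [q], so [choice] gives a map
    computable with any denominator. *)
Lemma localization_value (q : loc) : exists z : Q, forall s r,
  den_set D s -> to_loc s * q = to_loc r -> f s * z = f r.
Proof.
have [s0 [r0 [D0 e0]]] := localization_eq_fraction q.
have [v [sv vs]] := f_unit D0; exists (v * f r0) => s r Ds e.
have [[[_ _ DM] DO] _] := den_axiom D.
(* Once the denominators agree, so do the numerators up to [ass D], and [t] removes the
   difference. *)
have [a [b [Da ab]]] := DO s s0 D0.
have [t Dt te] : exists2 t, den_set D t & t * (a * r) = t * (b * r0).
  apply: to_localization_eq.
  by rewrite !rmorphM /= -e -e0 !mulrA -!rmorphM ab.
apply: (invertible_lreg (f_unit (DM _ _ Dt Da))).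
rewrite -(rmorphM f (t * a)) -(mulrA t) te (mulrA (f (t * a))) -rmorphM.
rewrite -(mulrA t) ab.
by rewrite !rmorphM -!mulrA (mulrA (f s0)) sv mul1r.
Qed.

Lemma localization_lift :
  exists g : {rmorphism loc -> Q}, forall r, g (to_loc r) = f r.
Proof.
have [g gP] := choice localization_value.
have gE q s z : den_set D s -> f s * g q = f s * z -> g q = z.
  by move=> /f_unit us /(invertible_lreg us).
have gloc r : g (to_loc r) = f r.
  have [[[D1 _ _] _] _] := den_axiom D.
  by apply: (gE _ 1) => //; rewrite (gP _ _ r) // ?rmorph1 ?mul1r.
have [||h hg] := @rmorphism_build _ _ g; last by exists h => r; rewrite hg.
- move=> p q; have [s [r [r' [Ds e e']]]] := localization_common p q.
  apply: (gE _ s) => //; rewrite mulrBr (gP _ _ _ Ds e) (gP _ _ _ Ds e').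
  by rewrite (gP _ _ (r - r')) ?rmorphB //= mulrBr e e'.
- split=> [|p q]; first by rewrite -(rmorph1 to_loc) gloc rmorph1.
  have [[[_ _ DM] DO] _] := den_axiom D.
  have [s [r [Ds e]]] := localization_eq_fraction q.
  have [t [u [Dt e']]] := localization_eq_fraction p.
  (* Moving the numerator [u] of [p] past the denominator [s] of [q] gives the product as the
     fraction of [b * r] over [a * t]. *)
  have [a [b [Da ab]]] := DO u s Ds.
  apply: (gE _ (a * t)); first exact: DM.
  rewrite (gP _ _ (b * r)); first last.
  + rewrite !rmorphM /= -e -mulrA (mulrA (to_loc t)) e' !mulrA.
    by rewrite -!rmorphM ab.
  + exact: DM.
  rewrite !rmorphM -(gP _ _ _ Ds e) mulrA -rmorphM -ab rmorphM.
  by rewrite -(gP _ _ _ Dt e') !mulrA.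
Qed.

Lemma localization_lift_inj (g : {rmorphism loc -> Q}) :
  (forall r, g (to_loc r) = f r) -> (forall r, f r = 0 -> ass D r) ->
  injective g.
Proof.
move=> gf kerf; apply: raddf_inj => q gq0.
have [s [r [Ds e]]] := localization_eq_fraction q.
apply: (invertible_lreg (to_localization_unit Ds)); rewrite mulr0 e.
by apply/to_localization_ker/kerf; rewrite -gf -e rmorphM gq0 mulr0.
Qed.

Lemma localization_lift_iso :
  (forall r, f r = 0 -> ass D r) ->
  (forall q, exists s r, den_set D s /\ f s * q = f r) ->
  exists2 g : {rmorphism loc -> Q},
    (forall r, g (to_loc r) = f r) & bijective g.
Proof.
move=> kerf dense; have [g gf] := localization_lift; exists g => //.
have ginj := localization_lift_inj gf kerf.
have gsurj q : exists p, g p = q.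
  have [s [r [Ds e]]] := dense q; exists (Defs.frac D s r).
  apply: (invertible_lreg (f_unit Ds)).
  by rewrite e -(gf s) -rmorphM fracE // gf.
have [h hP] := choice gsurj.
by exists h => [p|]; [apply: ginj; rewrite hP | exact: hP].
Qed.

End LocalizationLift.

(** * Denominator sets modulo an ideal contained in [ass D] *)

Section QuotientDen.
Variables (R : nzRingType) (J : properIdeal R) (D : set R).
Hypotheses (DD : Den_l R D) (JD : J `<=` ass D).
Local Notation pi := (to_quotient J).

Lemma to_quotient_eq0 x : pi x = 0 <-> ideal_set J x.
Proof.
by rewrite -(rmorph0 pi) -[X in ideal_set J X]subr0; exact: to_quotientP.
Qed.

Lemma quotient_Den : Den_l _ (pi @` D).
Proof.
have [[[D1 D0 DM] DO] DD'] := DD; split; first split; first split.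
- by exists 1; rewrite ?rmorph1.
- by move=> [s Ds /to_quotient_eq0/JD]; apply: Den_ass_disjoint.
- move=> _ _ [s Ds <-] [t Dt <-].
  by exists (s * t); rewrite ?rmorphM //; exact: DM.
- move=> p _ [s Ds <-]; have [r <-] := to_quotient_surj p.
  have [s' [r' [Ds' e]]] := DO r s Ds; exists (pi s'), (pi r').
  by rewrite -!rmorphM e; split=> //; exists s'.
- move=> p _ [s Ds <-]; have [r <-] := to_quotient_surj p.
  rewrite -rmorphM => /to_quotient_eq0/JD[t Dt]; rewrite mulrA => e.
  have [u Du uE] := DD' _ _ Ds e; exists (pi (u * t)).
    by exists (u * t) => //; exact: DM.
  by rewrite -rmorphM -mulrA uE rmorph0.
Qed.

(** Relations in the quotient lift to [R] up to [J]. An element [d] of [D] kills the error, and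
    multiplying by it stays in the preimage because [T] contains the image of [D]. *)
Lemma quotient_preimage_Den (T : set (quotient_ring J)) :
  Den_l _ T -> pi @` D `<=` T -> Den_l R (pi @^-1` T).
Proof.
move=> [[[T1 T0 TM] TO] TD] DT.
have TMp x y : T (pi x) -> T (pi y) -> T (pi (x * y)).
  by move=> Tx Ty; rewrite rmorphM; apply: TM.
have Tp s : D s -> T (pi s) by move=> Ds; apply: DT; exists s.
split; first split; first split => /=; rewrite ?rmorph0 ?rmorph1 //.
- move=> r s /= Ts; have [p [q []]] := TO (pi r) _ Ts.
  have [t <-] := to_quotient_surj p; have [a <-] := to_quotient_surj q.
  move=> Tt; rewrite -!rmorphM => /to_quotientP/JD[d Dd e].
  exists (d * t), (d * a); split; first by apply: TMp => //; exact: Tp.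
  by apply/eqP; rewrite -subr_eq0 -!mulrA -mulrBr e.
- move=> r s /= Ts rs; have [|p] := TD (pi r) _ Ts.
    by rewrite -rmorphM rs rmorph0.
  have [t <-] := to_quotient_surj p => Tt; rewrite -rmorphM.
  move=> /to_quotient_eq0/JD[d Dd e].
  by exists (d * t); [apply: TMp => //; exact: Tp | rewrite -mulrA].
Qed.

(** The preimage of a larger [T] is a denominator set containing [D], so it is [D]. *)
Lemma quotient_max_Den : max_Den_l R D -> max_Den_l _ (pi @` D).
Proof.
move=> [_ Dmax]; split=> [|T DT DpT]; first exact: quotient_Den.
have <- : pi @^-1` T = D.
  apply: Dmax; first exact: quotient_preimage_Den.
  by move=> x Dx; apply: DpT; exists x.
apply/seteqP; split=> [p|_ [x Tx <-] //].
by have [x <-] := to_quotient_surj p; exists x.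
Qed.

Lemma quotient_max_DenP x : max_Den_l R D -> (pi @` D) (pi x) -> D x.
Proof.
move=> mD [y Dy /to_quotientP/JD yx].
apply: (@max_Den_addr_ass R (DenSet DD) x _ mD yx).
by rewrite addrC subrK.
Qed.

End QuotientDen.

(** * Projections of a finite product *)

Section ProductProjection.
Variables (n : nat) (Q_ : 'I_n -> nzRingType).

Definition prod_proj i (q : prod_ring Q_) : Q_ i := q i.

Lemma prod_proj_zmod i : zmod_morphism (prod_proj i).
Proof. by []. Qed.

Lemma prod_proj_monoid i : monoid_morphism (prod_proj i).
Proof. by []. Qed.

HB.instance Definition _ i := GRing.isZmodMorphism.Build (prod_ring Q_) (Q_ i)
  (prod_proj i) (prod_proj_zmod i).
HB.instance Definition _ i := GRing.isMonoidMorphism.Build (prod_ring Q_) (Q_ i)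
  (prod_proj i) (prod_proj_monoid i).

Lemma prod_ringP (p q : prod_ring Q_) :
  (forall i, prod_proj i p = prod_proj i q) -> p = q.
Proof. exact: functional_extensionality_dep. Qed.

Lemma invertible_prodP (q : prod_ring Q_) :
  invertible q <-> forall i, invertible (prod_proj i q).
Proof.
split=> [uq i|uq]; first exact: rmorph_invertible.
exists (fun i => sval (cid (uq i))).
split; apply: prod_ringP => i; rewrite rmorphM rmorph1;
  by case: (svalP (cid (uq i))).
Qed.

End ProductProjection.

(** * Rings embedded in a finite product as an order *)

Section FractionEmbedding.
Variables (R : nzRingType) (n : nat) (Q_ : 'I_n -> nzRingType).
Variable f : forall i, {rmorphism R -> Q_ i}.

Definition fraction_embedding :=
  [/\ forall i, unit_or_nilpotent (Q_ i),
      forall r, (forall i, f i r = 0) -> r = 0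
    & forall q : forall i, Q_ i, exists t r,
        forall i, invertible (f i t) /\ f i t * q i = f i r].

Hypothesis fE : fraction_embedding.

Lemma embedding_eq x y : (forall i, f i x = f i y) -> x = y.
Proof.
have [_ inj _] := fE => e; apply/eqP; rewrite -subr_eq0; apply/eqP/inj => i.
by rewrite rmorphB e subrr.
Qed.

(** The element [a] is a numerator of the i-th idempotent of the product. *)
Lemma embedding_separator i :
  exists2 a, invertible (f i a) & forall j, j != i -> f j a = 0.
Proof.
have [_ _ dense] := fE; have [t [a ta]] := dense (fun j => (j == i)%:R).
exists a => [|j /negPf ji]; last by have [_ <-] := ta j; rewrite ji mulr0.
by have [ut <-] := ta i; rewrite eqxx mulr1.
Qed.

Lemma embedding_regular :
  regular_elements R = [set t | forall i, invertible (f i t)].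
Proof.
have [UN inj _] := fE; apply/seteqP; split=> t; last first.
  by move=> ut; split=> r e; apply: inj => i;
    [apply: (invertible_lreg (ut i)) | apply: (invertible_rreg (ut i))];
    rewrite -rmorphM e rmorph0 ?mulr0 ?mul0r.
move=> [_ treg] i; have [//|[k tk0]] := UN i (f i t).
have [a ua a0] := embedding_separator i.
have regX m x : x * t ^+ m = 0 -> x = 0.
  elim: m => [|m IH]; first by rewrite mulr1.
  by rewrite exprSr mulrA => /treg.
(* The component at [i] is killed by [t ^+ k], all others by [a]; cancelling [t] would give
   [a = 0]. *)
have /regX a_0 : a * t ^+ k = 0.
  apply: inj => j; rewrite rmorphM rmorphXn.
  have [->|/a0->] := eqVneq j i; last by rewrite mul0r.
  by rewrite tk0 mulr0.
by move: ua; rewrite a_0 rmorph0 => /not_invertible0.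
Qed.

Lemma embedding_prod :
  exists F : {rmorphism R -> prod_ring Q_},
    forall i r, prod_proj i (F r) = f i r.
Proof.
have [||F FE] := @rmorphism_build R (prod_ring Q_) (fun r i => f i r).
- by move=> x y; apply: prod_ringP => i; rewrite rmorphB /prod_proj rmorphB.
- split=> [|x y]; apply: prod_ringP => i; rewrite ?rmorph1 ?rmorphM /prod_proj.
    by rewrite rmorph1.
  by rewrite rmorphM.
- by exists F => i r; rewrite FE.
Qed.

Lemma embedding_prod_invertible (F : {rmorphism R -> prod_ring Q_}) t :
  (forall i r, prod_proj i (F r) = f i r) ->
  invertible (F t) <-> regular_elements R t.
Proof.
move=> Ff; rewrite embedding_regular; split=> [/invertible_prodP ut i|ut].
  by rewrite -Ff.
by apply/invertible_prodP => i; rewrite Ff.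
Qed.

Lemma embedding_prod_dense (F : {rmorphism R -> prod_ring Q_})
    (q : prod_ring Q_) :
  (forall i r, prod_proj i (F r) = f i r) ->
  exists t r, regular_elements R t /\ F t * q = F r.
Proof.
move=> Ff; have [_ _ dense] := fE; have [t [r tr]] := dense q; exists t, r.
split; first by rewrite embedding_regular => i; case: (tr i).
by apply: prod_ringP => i; rewrite rmorphM /= !Ff; case: (tr i).
Qed.

(** The regular elements are the pullback of the units of the whole product. *)
Lemma embedding_regular_Ore : left_Ore (regular_elements R).
Proof.
have [_ inj _] := fE; have [F Ff] := embedding_prod.
have -> : regular_elements R = [set t | invertible (F t)].
  by apply/seteqP; split=> t /(embedding_prod_invertible t Ff).
suff [] : Den_l R [set t | invertible (F t)] by [].
have F0 r : F r = 0 -> r = 0.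
  by move=> e; apply: inj => i; rewrite -Ff e rmorph0.
apply: pullback_units_Den => [|q|r /F0 ->].
- rewrite -(rmorph1 F) => /F0/eqP; by rewrite oner_eq0.
- have [t [r []]] := embedding_prod_dense q Ff.
  move=> /(embedding_prod_invertible t Ff) ut e.
  by exists t, r.
- by exists 1; rewrite ?mulr0 // rmorph1; exact: invertible1.
Qed.

(** Stated for every such [D] because [Q_lcl] and [Q_l] come with differently built [denSet]s. *)
Lemma embedding_localization (D : denSet R) :
  den_set D = regular_elements R ->
  iso_product_of_local_rad_nil (localization D).
Proof.
move=> DE; have [UN inj _] := fE; have [F Ff] := embedding_prod.
exists n, Q_; split.
(* An empty product would force 1 = 0 in [R] by injectivity. *)
- case: n Q_ f inj => // Q0 f0 inj0.
  have /eqP : (1 : R) = 0 by apply: inj0 => -[].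
  by rewrite oner_eq0.
- have [s|r e|q|g _ gbij] := @localization_lift_iso R D _ F.
  + by rewrite DE => /(embedding_prod_invertible s Ff).
  + have -> : r = 0 by apply: inj => i; rewrite -Ff e rmorph0.
    by have [[]] := ass_is_ideal D.
  + by rewrite DE; exact: embedding_prod_dense.
  + by exists g.
- by move=> i; have [/(_ (UN i))[]] := unit_or_nilpotentP (Q_ i).
- by move=> i; have [/(_ (UN i))[]] := unit_or_nilpotentP (Q_ i).
Qed.

(** Each [f i] behaves like a localization map: extending [q] by 0 gives fractions, and a separator
    kills the kernel. *)
Lemma embedding_pullback_Den i : Den_l R [set t | invertible (f i t)].
Proof.
have [_ _ dense] := fE; apply: pullback_units_Den => [|q|r fr0].
- by apply/eqP; rewrite oner_eq0.
- have [t [r tr]] := dense (dfwith (fun j => 0 : Q_ j) q).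
  by exists t, r; have := tr i; rewrite dfwith_in.
- have [a ua a0] := embedding_separator i; exists a => //.
  apply: embedding_eq => j; rewrite rmorphM rmorph0.
  by have [->|/a0->] := eqVneq j i; rewrite ?fr0 ?mulr0 ?mul0r.
Qed.

(* If T lies in no pullback, it contains for each i an element killed by f i;
   the product of these is 0. *)
Lemma embedding_Den_sub T : Den_l R T ->
  exists i, T `<=` [set t | invertible (f i t)].
Proof.
move=> DT; have [[[T1 T0 TM] _] _] := DT; have [UN inj _] := fE.
apply: contrapT => /forallNP nT.
suff [t Tt t0] : exists2 t, T t & forall i, i \in enum 'I_n -> f i t = 0.
  by apply: T0; rewrite -(inj t) // => i; apply: t0; rewrite mem_enum.
elim: (enum _) => [|i s [t Tt t0]]; first by exists 1.
have [u [Tu nu]] : exists u, T u /\ ~ invertible (f i u).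
  apply: contrapT => /forallNP H; apply: (nT i) => u Tu.
  by apply: contrapT => nu; apply: (H u).
have [//|[k uk0]] := UN i (f i u).
exists (u ^+ k * t); first by apply: TM => //; exact: Den_exp.
move=> j; rewrite inE rmorphM => /predU1P[->|/t0->]; last by rewrite mulr0.
by rewrite rmorphXn uk0 mul0r.
Qed.

(** Different pullbacks are incomparable: a separator of [i] is a unit at [i] and 0 at every other
    index. *)
Lemma embedding_max_DenP T :
  max_Den_l R T <-> exists i, T = [set t | invertible (f i t)].
Proof.
split=> [[DT Tmax]|[i ->]].
  have [i Ti] := embedding_Den_sub DT; exists i.
  by rewrite (Tmax _ _ Ti) //; exact: embedding_pullback_Den.
split=> [|U DU TU]; first exact: embedding_pullback_Den.
have [j Uj] := embedding_Den_sub DU.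
have [a ua a0] := embedding_separator i.
have ij : j = i.
  apply: contrapT => /eqP/a0 fa0; have := Uj a (TU a ua).
  by rewrite /= fa0 => /not_invertible0.
by apply/seteqP; split=> //; rewrite ij in Uj.
Qed.

End FractionEmbedding.

(** * The classical and the largest left quotient ring *)

Section ClassicalQuotient.
Variable R : nzRingType.

Definition has_fraction_embedding := exists n (Q_ : 'I_n -> nzRingType)
  (f : forall i, {rmorphism R -> Q_ i}), fraction_embedding f.

Lemma localization_has_embedding (D : denSet R) :
  den_set D `<=` regular_elements R ->
  iso_product_of_local_rad_nil (localization D) -> has_fraction_embedding.
Proof.
move=> Dreg [n [Q_ [_ [g [h gh hg]] loc rad]]]; exists n, Q_.
pose f i : {rmorphism R -> Q_ i} := prod_proj i \o g \o to_localization D.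
exists f; split=> [i|r fr0|q].
- exact/unit_or_nilpotentP.
- have : to_localization D r = 0.
    apply: (can_inj gh); rewrite rmorph0; apply: prod_ringP => i.
    by rewrite rmorph0; exact: fr0.
  by move=> /to_localization_ker[t /Dreg[+ _]] => /[apply].
- have [t [r [Dt e]]] := localization_eq_fraction (h q); exists t, r => i.
  split; first apply: (@rmorph_invertible _ _ (prod_proj i)).
    by apply: rmorph_invertible; exact: to_localization_unit.
  by rewrite /f /= -e !rmorphM hg.
Qed.

Lemma Q_lcl_embeddingP :
  (exists H : left_Ore (regular_elements R),
     iso_product_of_local_rad_nil (Q_lcl H))
  <-> has_fraction_embedding.
Proof.
split=> [[H]|[n [Q_ [f fE]]]]; first exact: localization_has_embedding.
by exists (embedding_regular_Ore fE); exact: (embedding_localization fE).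
Qed.

(** Given an embedding, the regular elements form a left Ore set, so they make up all of [S_l0]. *)
Lemma Q_l_embeddingP :
  iso_product_of_local_rad_nil (Q_l R) <-> has_fraction_embedding.
Proof.
have [DS S0] := S_l0_Den R.
split=> [|[n [Q_ [f fE]]]].
  by apply: localization_has_embedding; exact: ass0_regular.
apply: (embedding_localization fE); apply/seteqP; split.
  exact: ass0_regular.
apply: S_l0_largest.
  by apply: regular_left_Ore_Den => //; exact: (embedding_regular_Ore fE).
have [[C1 _ _] _] := embedding_regular_Ore fE.
apply/seteqP; split=> [r [s [sreg _] /sreg]//|_ ->].
by exists 1; rewrite ?mulr0.
Qed.

End ClassicalQuotient.

(** * From statement 1 to an embedding of the quotient *)

Lemma finite_max_Den_enum (R : nzRingType) : finite_set (max_Den_l R) ->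
  exists n (D : 'I_n -> denSet R),
    [/\ forall i, max_Den_l R (D i),
        forall i j, i != j -> den_set (D i) <> den_set (D j)
      & forall S, max_Den_l R S -> exists i, S = den_set (D i)].
Proof.
move=> /finite_seqP[s sE]; pose u := undup s.
have uP S : max_Den_l R S <-> S \in u by rewrite mem_undup sE.
have Dp (i : 'I_(size u)) : max_Den_l R (nth set0 u i).
  by apply/uP/mem_nth.
exists (size u), (fun i => DenSet (Dp i).1); split=> [//|i j ij /= e|S /uP Su].
  move/eqP: ij; apply; apply/val_inj/eqP.
  by rewrite -(nth_uniq set0 (ltn_ord i) (ltn_ord j) (undup_uniq s)) -/u e.
have iS : (index S u < size u)%N by rewrite index_mem.
by exists (Ordinal iS); rewrite /= nth_index.
Qed.

Lemma loc_radical_sub (R : nzRingType) (S : set R) :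
  max_Den_l R S -> ideal_set (loc_radical R) `<=` ass S.
Proof. by move=> mS r; exact. Qed.

(** A non-nilpotent element lies in some maximal [S], hence outside [ass S]. *)
Lemma wll_loc_radical_nil (R : nzRingType) :
  weakly_left_localizable R -> is_nil_ideal (loc_radical R).
Proof.
move=> W; split=> [|r lr]; first exact: ideal_axiom.
apply: contrapT => /W[S0 DS0 S0r]; have [S mS /(_ _ S0r) Sr] := Den_sub_max DS0.
by have [DS _] := mS; exact: Den_ass_disjoint Sr (lr S mS).
Qed.

Section Separation.
Variables (R : nzRingType) (n : nat) (D : 'I_n -> denSet R).
Hypothesis mD : forall i, max_Den_l R (D i).
Hypothesis sepD : forall i j, i != j ->
  exists2 x, ass (D i) x & den_set (D j) x.

(** Multiply the pairwise separators: the product stays in [D j] and lies in each ideal [ass (D i)]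
    with [i != j]. *)
Lemma max_Den_separator j :
  exists x, den_set (D j) x /\ forall i, i != j -> ass (D i) x.
Proof.
suff [x Dx ax] : exists2 x, den_set (D j) x &
    forall i, i \in enum 'I_n -> i != j -> ass (D i) x.
  by exists x; split=> // i; apply: ax; rewrite mem_enum.
have [[[D1 _ DM] _] _] := den_axiom (D j).
elim: (enum _) => [|i s [x Dx ax]]; first by exists 1.
have [->|ij] := eqVneq i j.
  by exists x => // k; rewrite inE => /predU1P[->|/ax//]; rewrite eqxx.
have [y ay Dy] := sepD ij; exists (y * x); first exact: DM.
move=> k; rewrite inE => /predU1P[->|ks] kj.
  by have [_ IMr] := ass_is_ideal (D i); apply: IMr.
by have [[_ _ IM] _] := ass_is_ideal (D k); apply/IM/ax.
Qed.

Hypothesis unD : forall i, unit_or_nilpotent (localization (D i)).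
Hypothesis allD : forall S, max_Den_l R S -> exists i, S = den_set (D i).

Lemma quotient_has_embedding :
  has_fraction_embedding (quotient_ring (loc_radical R)).
Proof.
have fK i r : ideal_set (loc_radical R) r -> to_localization (D i) r = 0.
  by move=> lr; apply/to_localization_ker; exact: loc_radical_sub lr.
pose f i := sval (cid (quotient_lift (fK i))).
have fP i r : f i (to_quotient _ r) = to_localization (D i) r.
  exact: (svalP (cid (quotient_lift (fK i)))).
exists n, (fun i => localization (D i)), f; split=> // [p|q].
  have [r <-] := to_quotient_surj p => fr0; apply/to_quotient_eq0 => S mS.
  have [i ->] := allD mS; apply/to_localization_ker.
  by rewrite -fP fr0.
have [x xP] := choice max_Den_separator.
have [s sP] := choice (fun i => localization_eq_fraction (q i)).
have [r rP] := choice sP.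
(* The separators [x j] glue local data: over [D i] only the i-th summand survives. This combines
   the denominators [s] and the numerators [r] of the components into one fraction. *)
have mix (y : 'I_n -> R) i :
    to_localization (D i) (\sum_j x j * y j)
    = to_localization (D i) (x i * y i).
  rewrite rmorph_sum (bigD1 i) //= big1 ?addr0 // => j ji.
  have /to_localization_ker xj0 : ass (D i) (x j).
    by have [_] := xP j; apply; rewrite eq_sym.
  by rewrite rmorphM /= xj0 mul0r.
exists (to_quotient _ (\sum_j x j * s j)).
exists (to_quotient _ (\sum_j x j * r j)) => i.
rewrite !fP !mix; have [Ds e] := rP i; have [Dx _] := xP i; split.
  apply: to_localization_unit; have [[[_ _ DM] _] _] := den_axiom (D i).
  exact: DM.
by rewrite !rmorphM -mulrA e.
Qed.

End Separation.

Lemma quotient_ideal (R : nzRingType) (J : properIdeal R) (I : set R) :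
  is_ideal I -> is_ideal (to_quotient J @` I).
Proof.
move=> [[I0 ID IM] IMr]; split; first split.
- by exists 0; rewrite ?rmorph0.
- move=> _ _ [x Ix <-] [y Iy <-].
  by exists (x + y); rewrite ?rmorphD //; exact: ID.
- move=> a _ [x Ix <-]; have [r <-] := to_quotient_surj a.
  by exists (r * x); rewrite ?rmorphM //; exact: IM.
- move=> a _ [x Ix <-]; have [r <-] := to_quotient_surj a.
  by exists (x * r); rewrite ?rmorphM //; exact: IMr.
Qed.

(** Over [T] an element of [ass S] is nilpotent or a unit. A unit comes from [T] by maximality; if
    all were nilpotent, [ass S] would be nil modulo the kernel [ass T]. *)
Lemma not_nil_modulo_separator (R : nzRingType) (S T : denSet R) :
  max_Den_l R T -> unit_or_nilpotent (localization T) ->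
  ~ nil_modulo (ass S) (ass_ideal T) -> exists2 x, ass S x & den_set T x.
Proof.
move=> mT UN nnil; apply: contrapT => nex; apply: nnil; split.
  by apply/quotient_ideal/idealD; exact: ass_is_ideal.
move=> _ [_ [a Sa [b Tb <-]] <-].
have [ua|[k ak0]] := UN (to_localization T a).
  by case: nex; exists a => //; rewrite (max_Den_units mT).
exists k.
have -> : to_quotient (ass_ideal T) (a + b) = to_quotient (ass_ideal T) a.
  by apply/to_quotientP; rewrite addrAC subrr add0r.
rewrite -rmorphXn; apply/to_quotient_eq0/to_localization_ker.
by rewrite rmorphXn.
Qed.

(** The powers of [x] stay in [T], which is disjoint from [ass T]. *)
Lemma not_nil_moduloP (R : nzRingType) (S T : denSet R) x :
  ass S x -> den_set T x -> ~ nil_modulo (ass S) (ass_ideal T).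
Proof.
move=> Sx Tx [_ nil]; have [|k] := nil (to_quotient (ass_ideal T) x).
  exists x => //; exists x => //; exists 0; last exact: addr0.
  by have [[]] := ass_is_ideal T.
rewrite -rmorphXn => /to_quotient_eq0.
apply: Den_ass_disjoint (den_axiom T) _.
exact: Den_exp (den_axiom T) Tx.
Qed.

(** * Maximal denominator sets of [R] and of [R'] *)

Section Main.
Variable R : nzRingType.
Local Notation l := (loc_radical R).
Local Notation R' := (quotient_ring l).
Local Notation pi := (to_quotient l).

Lemma quotient_localizable :
  set_surj (max_Den_l R) (max_Den_l R') (fun S => pi @` S) ->
  pi @` left_localizable R = left_localizable R'.
Proof.
move=> surj; apply/seteqP; split=> [_ [r [S0 DS0 S0r] <-]|p [T0 DT0 T0p]].
  have [S mS /(_ _ S0r) Sr] := Den_sub_max DS0; have [DS _] := mS.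
  exists (pi @` S); last by exists r.
  exact: quotient_Den DS (loc_radical_sub mS).
have [T mT /(_ _ T0p)] := Den_sub_max DT0.
by have [S [DS _] <-] := surj T mT => -[r Sr <-]; exists r => //; exists S.
Qed.

Lemma quotient_max_loc S : max_Den_l R S -> max_Den_l R' (pi @` S).
Proof.
move=> mS; have [DS _] := mS.
exact: (quotient_max_Den DS (loc_radical_sub mS) mS).
Qed.

Lemma quotient_max_locP S x : max_Den_l R S -> (pi @` S) (pi x) -> S x.
Proof.
move=> mS; have [DS _] := mS.
exact: (quotient_max_DenP DS (loc_radical_sub mS) mS).
Qed.

Lemma quotient_max_inj S T : max_Den_l R S -> max_Den_l R T ->
  pi @` S = pi @` T -> S = T.
Proof.
move=> mS mT e; apply/seteqP; split=> x Hx.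
  by apply: quotient_max_locP => //; rewrite -e; exists x.
by apply: quotient_max_locP => //; rewrite e; exists x.
Qed.

(** * From an embedding of [R'] to statement 1 *)

Section FromEmbedding.
Variables (n : nat) (Q_ : 'I_n -> nzRingType).
Variable f : forall i, {rmorphism R' -> Q_ i}.
Hypotheses (fE : fraction_embedding f) (lnil : is_nil_ideal l).
Hypothesis locE : pi @` left_localizable R = left_localizable R'.

(** If some component of [pi r] is a unit, [pi r] is localizable and [locE] lifts it to an [x] in a
    maximal [S]; then [r] is in [S] too, since [x - r] lies in [ass S]. *)
Lemma embedding_wll : weakly_left_localizable R.
Proof.
have [UN inj _] := fE; move=> r nr.
have [i ui] : exists i, invertible (f i (pi r)).
  apply: contrapT => /forallNP nu; apply: nr.
  have nil i : exists k, f i (pi r) ^+ k = 0.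
    by case: (UN i (f i (pi r))) => // /nu.
  have [k kP] := choice nil.
  (* The sum of the [k i] is an exponent large enough for all components at once. *)
  have : pi (r ^+ (\sum_i k i)) = 0.
    by apply: inj => i; rewrite !rmorphXn (bigD1 i) //= exprD kP mul0r.
  move=> /to_quotient_eq0; have [_ lN] := lnil => /lN[m]; rewrite -exprM => e.
  by exists ((\sum_i k i) * m)%N.
have : left_localizable R' (pi r).
  by exists [set t | invertible (f i t)] => //; exact: embedding_pullback_Den.
rewrite -locE => -[x [S0 DS0 S0x] /to_quotientP xr].
have [S mS /(_ _ S0x) Sx] := Den_sub_max DS0; have [DS _] := mS; exists S => //.
apply: (@max_Den_addr_ass R (DenSet DS) r (x - r) mS).
  exact: loc_radical_sub xr.
by rewrite addrC subrK.
Qed.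

Lemma embedding_max S : max_Den_l R S ->
  exists i, pi @` S = [set t | invertible (f i t)].
Proof. by move=> /quotient_max_loc /(embedding_max_DenP fE). Qed.

(** A separator of [i] lies in the i-th pullback only, so a maximal [S] containing a lift of a
    separator has that pullback as its image. *)
Lemma embedding_surj : set_surj (max_Den_l R) (max_Den_l R') (fun S => pi @` S).
Proof.
move=> T /(embedding_max_DenP fE)[i ->].
have [a ua a0] := embedding_separator fE i.
have : left_localizable R' a.
  by exists [set t | invertible (f i t)] => //; exact: embedding_pullback_Den.
rewrite -locE => -[x [S0 DS0 S0x] xa].
have [S mS /(_ _ S0x) Sx] := Den_sub_max DS0; exists S => //.
have [j Sj] := embedding_max mS; rewrite Sj.
suff -> : i = j by [].
apply: contrapT => /eqP; rewrite eq_sym => /a0 fa0.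
have : (pi @` S) a by exists x.
by rewrite Sj /= fa0 => /not_invertible0.
Qed.

(** A maximal [S] is the full preimage of its image, one of the n pullbacks. *)
Lemma embedding_finite : finite_set (max_Den_l R).
Proof.
pose T i := pi @^-1` [set t | invertible (f i t)].
apply: (@sub_finite_set _ _ (range T)); last exact: finite_image.
move=> S mS; have [i Si] := embedding_max mS; exists i => //.
apply/seteqP; split=> x; rewrite /T -Si; first exact: quotient_max_locP.
by exists x.
Qed.

(** For [s] in [S] lifting a separator of [i], the product [s * r] vanishes in every component, so
    it lies in [l] and hence in [ass S]. *)
Lemma embedding_ass S i : max_Den_l R S ->
  pi @` S = [set t | invertible (f i t)] ->
  forall r, f i (pi r) = 0 -> ass S r.
Proof.
move=> mS Si r fr0; have [a ua a0] := embedding_separator fE i.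
have : (pi @` S) a by rewrite Si.
move=> [s Ss sa]; have [t St tr] : ass S (s * r).
  apply: (loc_radical_sub mS); apply/to_quotient_eq0.
  apply: (embedding_eq fE) => j; rewrite rmorphM /= sa rmorphM rmorph0.
  by have [->|/a0->] := eqVneq j i; rewrite ?fr0 ?mulr0 ?mul0r.
have [[[[_ _ SM] _] _] _] := mS.
by exists (t * s); rewrite -?mulrA //; exact: SM.
Qed.

(** The localization embeds in [Q_ i] by [g]. Injectivity reflects nilpotence; if [g q] is a unit,
    so is the image of the numerator of [q], which therefore lies in [S]. *)
Lemma embedding_localization_un (S : denSet R) : max_Den_l R S ->
  unit_or_nilpotent (localization S).
Proof.
move=> mS q; have [i Si] := embedding_max mS; have [UN _ _] := fE.
pose h : {rmorphism R -> Q_ i} := f i \o pi.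
have hS s : den_set S s <-> invertible (h s).
  split=> [Ss|us]; first by have : (pi @` S) (pi s) by [exists s]; rewrite Si.
  by apply: (quotient_max_locP mS); rewrite Si.
have h_unit s : den_set S s -> invertible (h s) by move/hS.
have [g gh] := localization_lift h_unit.
have ginj := localization_lift_inj gh (embedding_ass mS Si).
have [s [r [Ss e]]] := localization_eq_fraction q.
have [ug|[k gk0]] := UN i (g q); [left|right]; last first.
  by exists k; apply: ginj; rewrite rmorphXn gk0 rmorph0.
apply: (invertible_mulKl (to_localization_unit Ss)); rewrite e.
apply/to_localization_unit/hS; rewrite -gh -e rmorphM gh.
by apply: invertibleM => //; exact: h_unit.
Qed.

(** A lift to [T] of the separator of [j] is killed by [f i], hence lies in [ass S]. *)
Lemma embedding_not_nil (S T : denSet R) : max_Den_l R S -> max_Den_l R T ->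
  den_set S <> den_set T -> ~ nil_modulo (ass S) (ass_ideal T).
Proof.
move=> mS mT ST.
have [i Si] := embedding_max mS; have [j Tj] := embedding_max mT.
have ij : i != j.
  apply/eqP => ij; apply: ST; apply: quotient_max_inj => //.
  by rewrite Si Tj ij.
have [a ua a0] := embedding_separator fE j.
have : (pi @` T) a by rewrite Tj.
move=> [x Tx xa]; apply: (not_nil_moduloP (x := x)) Tx.
by apply: (embedding_ass mS Si); rewrite xa a0.
Qed.

End FromEmbedding.
End Main.

Theorem theorem3p12 (R : nzRingType) :
  let l := loc_radical R in
  let R' : nzRingType := quotient_ring l in
  let pi' : R -> R' := to_quotient l in
  let statement1 :=
    weakly_left_localizable R /\
    [/\ set_surj (max_Den_l R) (max_Den_l R') (fun S => pi' @` S),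
        finite_set (max_Den_l R),
        (forall S : denSet R, max_Den_l R S ->
           weakly_left_localizable (localization S))
      & (forall S T : denSet R, max_Den_l R S -> max_Den_l R T ->
           den_set S <> den_set T -> ~ nil_modulo (ass S) (ass_ideal T))] in
  let statement2 :=
    [/\ (exists H : left_Ore (regular_elements R'),
           iso_product_of_local_rad_nil (Q_lcl H)),
        is_nil_ideal l
      & pi' @` left_localizable R = left_localizable R'] in
  let statement3 :=
    [/\ iso_product_of_local_rad_nil (Q_l R'),
        is_nil_ideal l
      & pi' @` left_localizable R = left_localizable R'] in
  (statement1 <-> statement2) /\ (statement2 <-> statement3).
Proof.
move=> l R' pi' s1 s2 s3; split; last first.
  split=> -[Q lnil locE]; split=> //.
    (* Both conditions on quotient rings amount to [has_fraction_embedding]. *)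
    by apply/Q_l_embeddingP/Q_lcl_embeddingP.
  by apply/Q_lcl_embeddingP/Q_l_embeddingP.
split=> [[W [surj fin locW sep]]|[/Q_lcl_embeddingP[n [Q_ [f fE]]] lnil locE]].
  split; [|exact: wll_loc_radical_nil|exact: quotient_localizable].
  have [n [D [mD Dinj allD]]] := finite_max_Den_enum fin.
  have unD i : unit_or_nilpotent (localization (D i)).
    by apply: weakly_left_localizable_localization => //; exact: locW.
  apply/Q_lcl_embeddingP; apply: (quotient_has_embedding mD) => // i j ij.
  by apply: not_nil_modulo_separator => //; apply: sep => //; exact: Dinj.
split; first exact: embedding_wll fE lnil locE.
split; [exact: embedding_surj fE locE | exact: embedding_finite fE | |].
- move=> S mS; apply: unit_or_nilpotent_wll.
  exact: embedding_localization_un fE _ mS.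
- exact: embedding_not_nil fE.
Qed.
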